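(* The category $\mathbf{ACones}$ is cartesian closed.
   Context: Cones. A precone is a module $P$ over $\mathbb{R}_{\ge 0}$ with $x_1+x=x_2+x\Rightarrow x_1=x_2$ and $x_1+x_2=0\Rightarrow x_1=0$, ordered by $x\le y$ iff $y=x+z$ for some $z$. A cone is a precone with $\|\cdot\|:P\to\mathbb{R}_{\ge0}$ such that $\|\lambda x\|=\lambda\|x\|$, $\|x\|=0\Rightarrow x=0$, $\|x+y\|\le\|x\|+\|y\|$, $\|x\|\le\|x+y\|$, and every increasing sequence in $\mathcal{B}P=\{x:\|x\|\le 1\}$ has a lub in $P$ lying in $\mathcal{B}P$. $\omega$-continuous = monotone and preserving lubs of norm-bounded increasing sequences; $P'$ = cone of linear $\omega$-continuous maps $P\to\mathbb{R}_{\ge0}$. Measurability. Fix a small full subcategory $\mathbf{Ar}$ of measurable spaces, closed under binary products, containing the one-point space $0$, with non-empty objects. A measurability structure on $P$ is a family $(\mathcal{M}_X)_{X\in\mathbf{Ar}}$ of sets of maps $m:X\times P\to\mathbb{R}_{\ge0}$ with $m(r,\cdot)\in P'$ such that: (i) $r\mapsto m(r,x)$ measurable into $[0,1]$ for $x\in\mathcal{B}P$; (ii) $(s,x)\mapsto m(\phi(s),x)\in\mathcal{M}_Y$ for $\phi\in\mathbf{Ar}(Y,X)$; (iii) $\mathcal{M}_0$ separates points; (iv) $\|x\|=\sup\{m(x)/\|m\|:m\in\mathcal{M}_0\setminus\{0\}\}$. Paths of arity $X$ in $C$: bounded $\gamma:X\to C$ with $(s,r)\mapsto m(s,\gamma(r))$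 measurable for all $Y\in\mathbf{Ar}$, $m\in\mathcal{M}_Y$. Integral over finite $\mu$: the $x$ with $m(x)=\int m(\gamma(r))\mu(dr)$ for all $m\in\mathcal{M}_0$. Integrable cone: all such integrals exist. Analytic functions. For integrable cones $B,C$ and $n\in\mathbb{N}$, $\mathrm{Sym}_n(B,C)$ is the set of maps $h:B^n\to C$ that are linear and $\omega$-continuous in each argument separately, symmetric, measurable (for every $X\in\mathbf{Ar}$ and paths $\beta_1,\dots,\beta_n$ of arity $X$ in $B$, $r\mapsto h(\beta_1(r),\dots,\beta_n(r))$ is a path in $C$) and integral preserving in each argument separately. A function $f:\mathcal{B}B\to C$ is analytic if it is bounded and there are $h_n\in\mathrm{Sym}_n(B,C)$ ($n\in\mathbb{N}$) with $f(x)=\sum_{n=0}^\infty h_n(x,\dots,x)$ (lub of the increasing partial sums) for all $x\in\mathcal{B}B$; it is measurable if $f\circ\beta$ is a path in $C$ for every path $\beta$ of arity $X$ in $B$ with values in $\mathcal{B}B$. $\mathbf{ACones}$ is the category whose objects are integrable cones and whose morphisms $B\to C$ are analytic measurable $f:\mathcal{B}B\to C$ with $\sup_{x\in\mathcal{B}B}\|f(x)\|\le1$, composed as functions. *)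

(* Defs.v *)
From HB Require Import structures.
From mathcomp Require Import all_boot all_order all_fingroup all_algebra.
From mathcomp Require Import all_classical all_reals all_analysis.

Set Implicit Arguments.
Unset Strict Implicit.
Unset Printing Implicit Defensive.

Import Order.TTheory GRing.Theory Num.Theory.

Local Open Scope classical_set_scope.
Local Open Scope ring_scope.

(** * The semiring of nonnegative reals *)

Definition Rnn (R : realType) : Type := {x : R | x \is Num.nneg}.

HB.instance Definition _ (R : realType) := SubChoice.on (Rnn R).
HB.instance Definition _ (R : realType) :=
  [SubChoice_isSubComNzSemiRing of Rnn R by <:].

(** * Arities *)

(* A small full subcategory of measurable spaces, presented as a family indexed
   by a type: a morphism from [X] to [Y] is any measurable function.  The spaces
   are nonempty because a [measurableType] is pointed.  Closure under products
   and the presence of the one-point space are asked up to isomorphism. *)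
Record arities : Type := Arities {
  ar_ob : Type;
  ar_disp : ar_ob -> measure_display;
  ar_space : forall X : ar_ob, measurableType (ar_disp X);
  ar_one : ar_ob;
  ar_pt : ar_space ar_one;
  ar_onePt : forall s : ar_space ar_one, s = ar_pt;
  ar_prod : forall X Y : ar_ob, exists (Z : ar_ob)
    (f : ar_space Z -> ar_space X * ar_space Y)
    (g : ar_space X * ar_space Y -> ar_space Z),
    [/\ measurable_fun setT f, measurable_fun setT g, cancel f g & cancel g f]
}.

Coercion ar_space : ar_ob >-> Measurable.type.
Arguments ar_pt {_}.

(** * Cones *)

HB.mixin Record isPrecone (R : realType) P of GRing.LSemiModule (Rnn R) P := {
  precone_addIr : forall x x1 x2 : P, x1 + x = x2 + x -> x1 = x2;
  precone_add_eq0 : forall x1 x2 : P, x1 + x2 = 0 -> x1 = 0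
}.

#[short(type="preconeType")]
HB.structure Definition Precone (R : realType) :=
  {P of isPrecone R P & GRing.LSemiModule (Rnn R) P}.

Definition cle (R : realType) (P : preconeType R) (x y : P) : Prop :=
  exists z : P, y = x + z.

Definition is_lub (T : Type) (le : T -> T -> Prop) (u : nat -> T) (x : T) :
    Prop :=
  (forall n, le (u n) x) /\ (forall y, (forall n, le (u n) y) -> le x y).

Definition cincreasing (R : realType) (P : preconeType R) (u : nat -> P) :
    Prop :=
  forall n, cle (u n) (u n.+1).

HB.mixin Record isCone (R : realType) P of Precone R P := {
  cnorm : P -> R;
  cnorm_ge0 : forall x : P, 0 <= cnorm x;
  cnormZ : forall (l : Rnn R) (x : P), cnorm (l *: x) = \val l * cnorm x;
  cnorm0_eq0 : forall x : P, cnorm x = 0 -> x = 0;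
  ler_cnormD : forall x y : P, cnorm (x + y) <= cnorm x + cnorm y;
  ler_cnormDr : forall x y : P, cnorm x <= cnorm (x + y);
  cone_complete : forall u : nat -> P,
    cincreasing u -> (forall n, cnorm (u n) <= 1) ->
    exists2 x : P, is_lub (@cle R P) u x & cnorm x <= 1
}.

#[short(type="coneType")]
HB.structure Definition Cone (R : realType) := {P of isCone R P & Precone R P}.

(* The unit ball. *)
Definition uball (R : realType) (P : coneType R) : Type :=
  {x : P | cnorm x <= 1}.

(* The codomain [T] is a cone with [cle], or [R] with its usual order. *)
Definition omega_continuous (R : realType) (P : coneType R) (T : Type)
    (le : T -> T -> Prop) (f : P -> T) : Prop :=
  (forall x y, cle x y -> le (f x) (f y)) /\
  (forall (u : nat -> P) (x : P), cincreasing u ->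
     (exists M : R, forall n, cnorm (u n) <= M) ->
     is_lub (@cle R P) u x -> is_lub le (f \o u) (f x)).

(* The dual cone, of which the members are seen as functions into [R]. *)
Definition in_dual (R : realType) (P : coneType R) (f : P -> R) : Prop :=
  [/\ forall x, 0 <= f x,
      forall x y, f (x + y) = f x + f y,
      forall (l : Rnn R) x, f (l *: x) = \val l * f x
    & omega_continuous (fun a b : R => a <= b) f].

Definition dual_norm (R : realType) (P : coneType R) (f : P -> R) : R :=
  sup [set f x | x in [set x : P | cnorm x <= 1]].

(** * Measurable and integrable cones *)

(* Members of [mtest ar_one] are identified with maps [P -> R] by evaluating
   them at [ar_pt].  In [mtest_norm], the set of which the supremum is taken is
   bounded by [mtest_dual] and [mtest_meas]; it is empty when [P] is trivial,
   with [sup set0 = 0]. *)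
HB.mixin Record isMeasurableCone (R : realType) (Ar : arities) P
    of Cone R P := {
  mtest : forall X : ar_ob Ar, set (X -> P -> R);
  mtest_dual : forall (X : ar_ob Ar) (m : X -> P -> R), mtest X m ->
    forall r : X, in_dual (m r);
  mtest_meas : forall (X : ar_ob Ar) (m : X -> P -> R), mtest X m ->
    forall x : P, cnorm x <= 1 ->
    measurable_fun [set: X] (fun r : X => m r x) /\
    (forall r : X, 0 <= m r x <= 1);
  mtest_comp : forall (X Y : ar_ob Ar) (phi : Y -> X) (m : X -> P -> R),
    measurable_fun [set: Y] phi -> mtest X m ->
    mtest Y (fun s x => m (phi s) x);
  mtest_sep : forall x1 x2 : P,
    (forall m, mtest (ar_one Ar) m -> m ar_pt x1 = m ar_pt x2) -> x1 = x2;
  mtest_norm : forall x : P,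
    cnorm x = sup [set m ar_pt x / dual_norm (m ar_pt) |
                    m in [set m | mtest (ar_one Ar) m /\
                                  m ar_pt <> (fun _ : P => 0)]]
}.

#[short(type="measurableConeType")]
HB.structure Definition MeasurableCone (R : realType) (Ar : arities) :=
  {P of isMeasurableCone R Ar P & Cone R P}.

Definition is_path (R : realType) (Ar : arities) (C : measurableConeType R Ar)
    (X : ar_ob Ar) (gamma : X -> C) : Prop :=
  (exists M : R, forall r, cnorm (gamma r) <= M) /\
  (forall (Y : ar_ob Ar) (m : Y -> C -> R), mtest Y m ->
     measurable_fun [set: Y * X] (fun p : Y * X => m p.1 (gamma p.2))).

Definition is_integral (R : realType) (Ar : arities)
    (C : measurableConeType R Ar) (X : ar_ob Ar) (gamma : X -> C)
    (mu : {finite_measure set X -> \bar R}) (x : C) : Prop :=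
  forall m, mtest (ar_one Ar) m ->
    (m ar_pt x)%:E = (\int[mu]_r (m ar_pt (gamma r))%:E)%E.

HB.mixin Record isIntegrableCone (R : realType) (Ar : arities) P
    of MeasurableCone R Ar P := {
  cone_integral : forall (X : ar_ob Ar) (gamma : X -> P), is_path gamma ->
    forall mu : {finite_measure set X -> \bar R},
    exists x : P, is_integral gamma mu x
}.

#[short(type="integrableConeType")]
HB.structure Definition IntegrableCone (R : realType) (Ar : arities) :=
  {P of isIntegrableCone R Ar P & MeasurableCone R Ar P}.

(** * Analytic functions *)

Section Analytic.
Context {R : realType} {Ar : arities}.
Implicit Types B C : integrableConeType R Ar.

Definition integral_preserving B C (f : B -> C) : Prop :=
  forall (X : ar_ob Ar) (gamma : X -> B), is_path gamma ->
  forall (mu : {finite_measure set X -> \bar R}) (x : B),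
    is_integral gamma mu x -> is_integral (f \o gamma) mu (f x).

(* [dfwith v x] is [v] with its [i]-th component replaced by [x]. *)
Definition separately B C (Q : (B -> C) -> Prop) n (h : ('I_n -> B) -> C) :
    Prop :=
  forall (i : 'I_n) (v : 'I_n -> B), Q (fun x : B => h (@dfwith _ (fun _ => B) v i x)).

Definition linear_map B C (f : B -> C) : Prop :=
  (forall x y, f (x + y) = f x + f y) /\
  (forall (l : Rnn R) x, f (l *: x) = l *: f x).

Record in_Sym B C n (h : ('I_n -> B) -> C) : Prop := InSym {
  sym_linear : separately (@linear_map B C) h;
  sym_continuous : separately (omega_continuous (@cle R C)) h;
  sym_symmetric : forall (s : 'S_n) (v : 'I_n -> B), h (v \o s) = h v;
  sym_measurable : forall (X : ar_ob Ar) (beta : 'I_n -> X -> B),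
    (forall i, is_path (beta i)) -> is_path (fun r => h (fun i => beta i r));
  sym_integral : separately (@integral_preserving B C) h
}.

Definition analytic B C (f : uball B -> C) : Prop :=
  (exists M : R, forall x, cnorm (f x) <= M) /\
  (exists2 h : forall n, ('I_n -> B) -> C, forall n, in_Sym (h n) &
     forall x : uball B,
       is_lub (@cle R C) (fun N => \sum_(n < N) h n (fun _ => \val x)) (f x)).

Definition measurable_map B C (f : uball B -> C) : Prop :=
  forall (X : ar_ob Ar) (beta : X -> uball B),
    is_path (fun r => \val (beta r)) -> is_path (f \o beta).

Record acones_hom B C : Type := AconesHom {
  ah_fun :> uball B -> C;
  ah_analytic : analytic ah_fun;
  ah_measurable : measurable_map ah_fun;
  ah_norm : forall x, cnorm (ah_fun x) <= 1
}.

Definition ah_ball B C (f : acones_hom B C) (x : uball B) : uball C :=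
  exist _ (f x) (ah_norm f x).

End Analytic.

(** * Cartesian closed categories *)

Record category (ob : Type) (hom : ob -> ob -> Type) : Type := Category {
  cat_id : forall a, hom a a;
  cat_comp : forall a b c, hom b c -> hom a b -> hom a c;
  cat_comp_idl : forall a b (f : hom a b), cat_comp (cat_id b) f = f;
  cat_comp_idr : forall a b (f : hom a b), cat_comp f (cat_id a) = f;
  cat_comp_assoc : forall a b c d (h : hom c d) (g : hom b c) (f : hom a b),
    cat_comp h (cat_comp g f) = cat_comp (cat_comp h g) f
}.

Section CartesianClosed.
Context (ob : Type) (hom : ob -> ob -> Type) (K : category hom).

Definition is_terminal (t : ob) : Prop :=
  forall a, exists! f : hom a t, True.

Definition is_product (a b p : ob) (p1 : hom p a) (p2 : hom p b) : Prop :=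
  forall c (f : hom c a) (g : hom c b),
    exists! h : hom c p, cat_comp K p1 h = f /\ cat_comp K p2 h = g.

(* [(e, ev)] is an exponential of [c] by [b], where [(eb, q1, q2)] is a product
   of [e] and [b].  In the universal property, [k] is the map [g * id_b]. *)
Definition is_exponential (b c e eb : ob) (q1 : hom eb e) (q2 : hom eb b)
    (ev : hom eb c) : Prop :=
  forall a ab (p1 : hom ab a) (p2 : hom ab b), is_product p1 p2 ->
  forall f : hom ab c, exists! g : hom a e,
    exists k : hom ab eb,
      [/\ cat_comp K q1 k = cat_comp K g p1, cat_comp K q2 k = p2 & cat_comp K ev k = f].

Definition cartesian_closed : Prop :=
  [/\ exists t, is_terminal t,
      forall a b, exists p (p1 : hom p a) (p2 : hom p b), is_product p1 p2
    & forall b c, exists e eb (q1 : hom eb e) (q2 : hom eb b) (ev : hom eb c),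
        is_product q1 q2 /\ is_exponential q1 q2 ev].

End CartesianClosed.

(* Main.v *)
(** A linear map is omega-continuous exactly when it preserves countable sums, and
    convergence of an increasing sequence can be tested with [mtest ar_one]; so
    every identity between analytic functions reduces to one between countable
    sums of nonnegative reals, which can be reordered freely.  Symmetrising and
    grouping by degree, a bounded countable sum of diagonals of multilinear maps
    is analytic; this gives composition, pairing, evaluation and currying.

    The exponential is the set of analytic functions with the supremum norm and
    the tests [(r, f) |-> m r (f (b r))], for [b] a path in the unit ball.  Its
    order and its integrals rest on the coefficients [h_n] of [f] being recovered
    from the values of [f]:
    [sum_e sgn(e) l (f (t * sum_i e_i v_i)) / t^n] tends to a positive multiple
    of [l (h_n v)] as [t] tends to 0, where [e] ranges over the subsets of
    [{1..n}].  The terms of degree below [n] cancel, and those above [n] are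
    [O(t)]. *)

From HB Require Import structures.
Require Import Defs.
From mathcomp Require Import all_boot all_order all_fingroup all_algebra.
From mathcomp Require Import all_classical all_reals all_analysis.
From mathcomp Require Import measurable_realfun.

Set Implicit Arguments.
Unset Strict Implicit.
Unset Printing Implicit Defensive.

Import Order.TTheory GRing.Theory Num.Theory.
Import numFieldNormedType.Exports.

Local Open Scope classical_set_scope.
Local Open Scope ring_scope.

(** * Countable sums of nonnegative reals *)

(** The obstacle is that order and subtraction in the function cone are algebraic: [cle f g] asks
    for an analytic difference, which a pointwise inequality does not provide. Lubs and integrals
    are therefore formed twice, on values and on coefficients, and then matched. The limit formula
    serves twice: it makes coefficients unique, hence additive in [f], and it shows that they depend
    measurably on any parameter on which [f] depends; Fubini-Tonelli then applies to them. The point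
    [b r] in a test has to move with the parameter: only so is evaluation jointly measurable along a
    path of functions and a path of points. Closure of the arities under products merges two such
    parameters into one. Multilinear maps are indexed by arbitrary finite types, because
    substitution, evaluation and currying produce dependent sums, options and subtypes; the
    renumbering by ['I_n] and the symmetrisation are done once, in [analytic_sum]. *)

Section RSum.
Context {R : realType}.

(** A relation with a real [s], so that finiteness of the sum is part of the statement. The index
    type is arbitrary, which turns reordering and regrouping into reindexing. *)
Definition rsum (K : choiceType) (a : K -> R) (s : R) : Prop :=
  s%:E = (\esum_(k in [set: K]) (a k)%:E)%E.

Lemma rsum_uniq (K : choiceType) (a : K -> R) s t :
  rsum a s -> rsum a t -> s = t.
Proof. by move=> h1 h2; apply: EFin_inj; rewrite h1 h2. Qed.

Lemma eq_rsum (K : choiceType) (a b : K -> R) s :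
  a =1 b -> rsum a s -> rsum b s.
Proof. by move=> ab; rewrite /rsum => ->; apply: eq_esum => i _; rewrite ab. Qed.

Lemma rsum_inj (K K' : choiceType) (e : K -> K') (a : K' -> R) s :
  injective e -> (forall k', (forall k, e k != k') -> a k' = 0) ->
  rsum (a \o e) s <-> rsum a s.
Proof.
move=> inje a0; rewrite /rsum.
suff -> : (\esum_(k in [set: K']) (a k)%:E =
           \esum_(k in [set: K]) ((a \o e) k)%:E)%E by [].
rewrite -(@esum_image _ _ _ setT e (fun k => (a k)%:E)); last first.
  by apply: in2W; exact: inje.
rewrite [RHS]esum_mkcond; apply: eq_esum => k' _.
case: ifPn => //; rewrite notin_setE => nk; rewrite a0// => k.
by apply: contra_notN nk => /eqP <-; exists k.
Qed.

Lemma rsum_single (K : choiceType) (a : K -> R) k0 :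
  0 <= a k0 -> (forall k, k != k0 -> a k = 0) -> rsum a (a k0).
Proof.
move=> a0 ak; apply/(@rsum_inj unit K (fun=> k0)).
- by move=> [] [].
- by move=> k' /(_ tt) h; rewrite ak// eq_sym.
- rewrite /rsum (_ : [set: unit] = [set tt]); last by apply/seteqP; split=> [[]|].
  by rewrite esum_set1//= lee_fin.
Qed.

Lemma rsum0 (K : choiceType) : rsum (fun _ : K => 0) 0.
Proof. by rewrite /rsum esum1. Qed.

Lemma rsum_fin (K : finType) (a : K -> R) :
  (forall k, 0 <= a k) -> rsum a (\sum_k a k).
Proof.
move=> a0; rewrite /rsum.
have -> : [set: K] = [set` enum K] by apply/seteqP; split => k //= _; rewrite mem_enum.
rewrite esum_fset => [||? _]; last 2 first.
- exact: finite_seq.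
- by rewrite lee_fin.
by rewrite -fsbig_seq ?enum_uniq// sumEFin big_enum.
Qed.

Lemma rsumD (K : choiceType) (a b : K -> R) s t :
  (forall k, 0 <= a k) -> (forall k, 0 <= b k) ->
  rsum a s -> rsum b t -> rsum (fun k => a k + b k) (s + t).
Proof.
move=> a0 b0; rewrite /rsum EFinD => -> ->; rewrite -esumD//.
- by move=> i _; rewrite lee_fin.
- by move=> i _; rewrite lee_fin.
Qed.

(** Tonelli. The equivalence also transfers summability: only the inner sums are assumed finite, and
    [t] may be given on either side. *)
Lemma rsum_pair (K1 K2 : choiceType) (a : K1 -> K2 -> R) s t :
  (forall i j, 0 <= a i j) -> (forall i, rsum (a i) (s i)) ->
  rsum s t <-> rsum (fun p => a p.1 p.2) t.
Proof.
move=> a0 as_; rewrite /rsum.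
suff -> : (\esum_(k in [set: K1]) (s k)%:E =
   \esum_(k in [set: K1 * K2]) (a k.1 k.2)%:E)%E by [].
under eq_esum do rewrite as_.
rewrite esum_esum; last by move=> *; rewrite lee_fin.
by congr esum; apply/seteqP; split.
Qed.

Lemma pickle_inv_Some (T : countType) n (j : T) :
  pickle_inv n = Some j -> pickle j = n.
Proof. by move=> E; have := @pickle_invK T n; rewrite /= E. Qed.

(** Tonelli for dependent indices, reduced to the binary case by pickling each fibre into [nat] and
    padding with zeros. *)
Lemma rsum_tag (K : countType) (T : K -> countType)
    (a : forall k, T k -> R) s t :
  (forall i j, 0 <= a i j) -> (forall i, rsum (@a i) (s i)) ->
  rsum s t <-> rsum (fun p : {k : K & T k} => a (tag p) (tagged p)) t.
Proof.
move=> a0 as_.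
pose b i n := oapp (@a i) 0 (pickle_inv n).
rewrite (@rsum_pair _ _ b); first last.
- move=> i; apply/(@rsum_inj _ _ pickle); first exact: pcan_inj pickleK_inv.
    move=> n h; rewrite /b; case E : (pickle_inv n) => [j|]//=.
    by have := h j; rewrite (pickle_inv_Some E) eqxx.
  by apply: eq_rsum (as_ i) => j; rewrite /b/= pickleK_inv.
- by move=> i j; rewrite /b; case: pickle_inv => /=.
pose e (p : {k : K & T k}) := (tag p, pickle (tagged p)).
rewrite -(@rsum_inj _ _ e (fun p => b p.1 p.2)).
- by split; apply: eq_rsum => -[k x]; rewrite /b/= pickleK_inv.
- move=> [i x] [j y]; rewrite /e/= => -[ij]; case: _ / ij y => y xy.
  by rewrite (pcan_inj pickleK_inv xy).
- move=> [i n] h; rewrite /b/=; case E : (pickle_inv n) => [j|]//=.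
  by have := h (Tagged (fun k => T k) j); rewrite /e/= (pickle_inv_Some E) eqxx.
Qed.

Lemma rsum_swap (K1 K2 : choiceType) (a : K1 -> K2 -> R) s t u :
  (forall i j, 0 <= a i j) -> (forall i, rsum (a i) (s i)) ->
  (forall j, rsum (a^~ j) (t j)) -> rsum s u <-> rsum t u.
Proof.
move=> a0 as_ at_; rewrite (rsum_pair u a0 as_) (@rsum_pair _ _ (fun j i => a i j) t)//.
have -> // := @rsum_inj (K1 * K2)%type (K2 * K1)%type (fun p => (p.2, p.1))
  (fun p => a p.2 p.1) u.
- by move=> [? ?] [? ?] /= [-> ->].
- by move=> [x y] /(_ (y, x)); rewrite eqxx.
Qed.

Lemma rsum_natP (a : nat -> R) s : (forall k, 0 <= a k) ->
  rsum a s <-> (fun N => \sum_(k < N) a k) @ \oo --> s.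
Proof.
move=> a0; rewrite /rsum -nneseries_esumT; last by move=> n; rewrite lee_fin.
have E : (fun N => (\sum_(0 <= k < N) (a k)%:E)%E) = EFin \o (fun N => \sum_(k < N) a k).
  by apply/funext => N /=; rewrite sumEFin big_mkord.
split=> [sE|cs].
  have h : cvgn (fun N => (\sum_(0 <= k < N) (a k)%:E)%E).
    by apply: is_cvg_nneseries => n _ _; rewrite lee_fin.
  have : (fun N => (\sum_(0 <= k < N) (a k)%:E)%E) @ \oo --> s%:E by rewrite sE.
  by rewrite E => /fine_cvgP[].
by apply/esym/cvg_lim => //; rewrite E; apply: cvg_EFin => //; exact: nearW.
Qed.

Lemma rsumZ (a : nat -> R) s c : 0 <= c -> (forall k, 0 <= a k) ->
  rsum a s -> rsum (fun k => c * a k) (c * s).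
Proof.
move=> c0 a0 /rsum_natP -/(_ a0) h; apply/rsum_natP => [k|]; first exact: mulr_ge0.
rewrite (_ : (fun N => _) = fun N => c * \sum_(k < N) a k).
  exact: (cvgM (cvg_cst c) h).
by apply/funext => N; rewrite mulr_sumr.
Qed.

(** A cone has no subtraction; this is how the difference of two expansions is summed, on the real
    side. *)
Lemma rsumB (a b c : nat -> R) s t u : (forall k, 0 <= b k) -> (forall k, 0 <= c k) ->
  rsum a s -> rsum b t -> (forall k, a k = b k + c k) -> s = t + u -> rsum c u.
Proof.
move=> b0 c0 as_ bt abc stu.
have a0 k : 0 <= a k by rewrite abc addr_ge0.
move: as_ bt => /rsum_natP -/(_ a0) ca /rsum_natP -/(_ b0) cb.
apply/rsum_natP => //.
have -> : u = s - t by rewrite stu addrC addKr.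
rewrite (_ : (fun N => _) = fun N => \sum_(k < N) a k - \sum_(k < N) b k).
  exact: cvgB.
by apply/funext => N; rewrite -sumrB; apply: eq_bigr => k _; rewrite abc addrC addKr.
Qed.

Lemma rsum_part (a : nat -> R) s N : (forall k, 0 <= a k) ->
  rsum a s -> \sum_(k < N) a k <= s.
Proof.
move=> a0 /rsum_natP -/(_ a0) cs; rewrite -(cvg_lim _ cs)//.
apply: (@nondecreasing_cvgn_le _ (fun N => \sum_(k < N) a k)); last exact: cvgP cs.
by apply/nondecreasing_seqP => n; rewrite big_ord_recr/= lerDl.
Qed.

End RSum.

(** * Cones *)

Section ConeBasics.
Context {R : realType}.

Definition nnr (x : R) : Rnn R := insubd 0 x.

Lemma val_nnr (x : R) : 0 <= x -> val (nnr x) = x.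
Proof. by move=> x0; rewrite /nnr insubdK// unfold_in. Qed.

Lemma val_Rnn_ge0 (a : Rnn R) : 0 <= val a.
Proof. exact: (valP a). Qed.

Lemma nnr1 : nnr 1 = 1.
Proof. by apply/val_inj; rewrite val_nnr. Qed.

Lemma nnrM (x y : R) : 0 <= x -> 0 <= y -> nnr (x * y) = nnr x * nnr y.
Proof.
by move=> x0 y0; apply/val_inj; rewrite /= !val_nnr// mulr_ge0.
Qed.

Implicit Types P : coneType R.

Lemma cle_refl (P : preconeType R) (x : P) : cle x x.
Proof. by exists 0; rewrite addr0. Qed.

Lemma cle_trans (P : preconeType R) (y x z : P) : cle x y -> cle y z -> cle x z.
Proof. by move=> [a ->] [b ->]; exists (a + b); rewrite addrA. Qed.

Lemma cle_addr (P : preconeType R) (x y : P) : cle x (x + y).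
Proof. by exists y. Qed.

Lemma cone_addrI (P : preconeType R) (x x1 x2 : P) : x + x1 = x + x2 -> x1 = x2.
Proof. rewrite !(addrC x); exact: precone_addIr. Qed.

Lemma cle_anti (P : preconeType R) (x y : P) : cle x y -> cle y x -> x = y.
Proof.
move=> [a ->] [b]; rewrite -addrA -[X in X = _]addr0 => /cone_addrI/esym/precone_add_eq0 ->.
by rewrite addr0.
Qed.

Lemma cle_norm P (x y : P) : cle x y -> cnorm x <= cnorm y.
Proof. by move=> [a ->]; exact: ler_cnormDr. Qed.

Lemma cle_scale (P : preconeType R) (l : Rnn R) (x y : P) : cle x y -> cle (l *: x) (l *: y).
Proof. by move=> [a ->]; exists (l *: a); rewrite scalerDr. Qed.

Lemma is_lub_uniq (P : preconeType R) (u : nat -> P) x y :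
  is_lub (@cle R P) u x -> is_lub (@cle R P) u y -> x = y.
Proof. by move=> [ux xl] [uy yl]; apply: cle_anti; [exact: xl|exact: yl]. Qed.

Lemma cnorm0 P : cnorm (0 : P) = 0.
Proof. by rewrite -(scale0r (0 : P)) cnormZ/= mul0r. Qed.

Lemma cnorm_nnr P (c : R) (x : P) : 0 <= c -> cnorm (nnr c *: x) = c * cnorm x.
Proof. by move=> c0; rewrite cnormZ val_nnr. Qed.

Lemma scale_nnrK (P : preconeType R) (c : R) (x : P) : 0 < c -> nnr c *: (nnr c^-1 *: x) = x.
Proof.
move=> c0; rewrite scalerA -nnrM ?invr_ge0 ?ltW// divff ?gt_eqF//.
by rewrite nnr1 scale1r.
Qed.

Lemma cone_complete_bnd P (u : nat -> P) (M : R) :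
  cincreasing u -> (forall n, cnorm (u n) <= M) ->
  exists2 x : P, is_lub (@cle R P) u x & cnorm x <= M.
Proof.
move=> iu uM.
have : 0 <= M := le_trans (cnorm_ge0 _) (uM 0%N).
(* The case [M = 0] is apart because the sequence is rescaled by [M^-1]. *)
rewrite le_eqVlt => /predU1P[M0|M0].
  have u0 n : u n = 0.
    by apply/cnorm0_eq0/le_anti; rewrite cnorm_ge0 M0 uM.
  exists 0; last by rewrite cnorm0 M0.
  by split=> [n|y /(_ 0%N)]; rewrite u0//; exact: cle_refl.
have [n|n|x [ux xl] nx] := @cone_complete R P (fun n => nnr M^-1 *: u n).
- exact: cle_scale.
- rewrite cnorm_nnr; last by rewrite invr_ge0 ltW.
  by rewrite ler_pdivrMl// mulr1.
exists (nnr M *: x); last by rewrite cnorm_nnr ?(ltW M0)// ger_pMr.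
split=> [n|y uy].
  by rewrite -(scale_nnrK (u n) M0); exact: (cle_scale _ (ux n)).
rewrite -(scale_nnrK y M0); apply: cle_scale; apply: xl => n.
by apply: cle_scale; exact: uy.
Qed.

Definition psum (P : preconeType R) (y : nat -> P) (N : nat) : P := \sum_(k < N) y k.

Lemma psumS (P : preconeType R) (y : nat -> P) N : psum y N.+1 = psum y N + y N.
Proof. by rewrite /psum big_ord_recr. Qed.

Lemma psum_incr (P : preconeType R) (y : nat -> P) : cincreasing (psum y).
Proof. by move=> n; rewrite psumS; exact: cle_addr. Qed.

(** The order is algebraic, so successive differences exist and can be chosen. The shift by one
    comes from [psum y 0] being the empty sum. *)
Lemma cincr_psum (P : preconeType R) (u : nat -> P) : cincreasing u ->
  exists2 y : nat -> P, y 0%N = u 0%N & forall N, psum y N.+1 = u N.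
Proof.
move=> /choice[d du].
exists (fun n => if n is n.+1 then d n else u 0%N) => // N.
elim: N => [|N IH]; first by rewrite psumS /psum big_ord0 add0r.
by rewrite psumS IH du.
Qed.

Lemma is_lubS (P : preconeType R) (u : nat -> P) x : cincreasing u ->
  is_lub (@cle R P) (fun n => u n.+1) x <-> is_lub (@cle R P) u x.
Proof.
move=> iu; split=> -[ux xl]; split=> [n|y uy].
- exact: cle_trans (iu n) (ux n).
- by apply: xl => n.
- exact: ux.
- by apply: xl => n; apply: cle_trans (uy n); exact: iu.
Qed.

Lemma real_lub_cvg (u : nat -> R) s : nondecreasing_seq u ->
  is_lub (fun a b : R => a <= b) u s <-> u @ \oo --> s.
Proof.
move=> ndu; split=> [[us sl]|us].
  have ubu : has_ubound (range u) by exists s => _ [n _ <-].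
  have -> : s = sup (range u).
    apply/le_anti/andP; split.
      by apply: sl => n; apply: ub_le_sup => //; exists n.
    by apply: ge_sup; [exists (u 0%N), 0%N|move=> _ [n _ <-]].
  exact: nondecreasing_cvgn.
split=> [n|y uy].
  by rewrite -(cvg_lim _ us)//; apply: nondecreasing_cvgn_le => //; exact: cvgP us.
rewrite -(cvg_lim _ us)//; apply: limr_le; first exact: cvgP us.
exact: nearW.
Qed.

(** * Functionals in the dual cone *)

Section Dual.
Variables (P : coneType R) (l : P -> R).
Hypothesis dl : in_dual l.

Lemma dual_ge0 x : 0 <= l x. Proof. by case: dl. Qed.
Lemma dualD x y : l (x + y) = l x + l y. Proof. by case: dl. Qed.
Lemma dualZ a x : l (a *: x) = val a * l x. Proof. by case: dl. Qed.
Lemma dual0 : l 0 = 0.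
Proof. by rewrite -(scale0r (0 : P)) dualZ/= mul0r. Qed.
Lemma dual_le x y : cle x y -> l x <= l y.
Proof. by move=> [z ->]; rewrite dualD lerDl dual_ge0. Qed.
Lemma dual_sum (I : Type) (s : seq I) (Q : pred I) (F : I -> P) :
  l (\sum_(i <- s | Q i) F i) = \sum_(i <- s | Q i) l (F i).
Proof. exact: (big_morph l dualD dual0). Qed.
Lemma dual_nd (u : nat -> P) : cincreasing u -> nondecreasing_seq (l \o u).
Proof. by move=> iu; apply/nondecreasing_seqP => n; exact: dual_le. Qed.

Lemma dual_lub (u : nat -> P) x : cincreasing u ->
  is_lub (@cle R P) u x -> l \o u @ \oo --> l x.
Proof.
move=> iu ux; apply/real_lub_cvg; first exact: dual_nd.
case: dl => _ _ _ [_ /(_ u x iu)]; apply=> //.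
(* A sequence that has a lub is norm-bounded by it. *)
by exists (cnorm x) => n; apply: cle_norm; case: ux.
Qed.

End Dual.

(** Weak sums: tested by functionals, they make sense over an unordered index type and pass through
    every map that pulls functionals back to functionals. *)
Definition csum (K : choiceType) P (y : K -> P) (x : P) : Prop :=
  forall l, in_dual l -> rsum (l \o y) (l x).

Lemma lub_csum P (y : nat -> P) x :
  is_lub (@cle R P) (psum y) x -> csum y x.
Proof.
move=> yx l dl; apply/rsum_natP => [k|]; first exact: dual_ge0.
rewrite (_ : (fun N => _) = l \o psum y); last first.
  by apply/funext => N /=; rewrite dual_sum.
by apply: dual_lub => //; exact: psum_incr.
Qed.

Lemma eq_csum (K : choiceType) P (y z : K -> P) x : y =1 z -> csum y x -> csum z x.
Proof. by move=> /funext ->. Qed.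

Lemma csum_fin (K : finType) P (y : K -> P) : csum y (\sum_k y k).
Proof.
by move=> l dl; rewrite dual_sum//; apply: rsum_fin => k; exact: dual_ge0.
Qed.

Lemma csum_inj (K K' : choiceType) (e : K -> K') P (y : K' -> P) x :
  injective e -> (forall k', (forall k, e k != k') -> y k' = 0) ->
  csum (y \o e) x <-> csum y x.
Proof.
move=> ie y0; split=> yx l dl.
  apply/(rsum_inj _ ie); last exact: yx.
  by move=> k' /y0 E; rewrite /= E dual0.
apply/(@rsum_inj _ _ _ _ (l \o y) _ ie); last exact: yx.
by move=> k' /y0 E; rewrite /= E dual0.
Qed.

Lemma in_dual_sigma P (l : P -> R) :
  (forall x, 0 <= l x) -> (forall x y, l (x + y) = l x + l y) ->
  (forall a x, l (a *: x) = val a * l x) ->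
  (forall (y : nat -> P) x, csum y x -> rsum (l \o y) (l x)) -> in_dual l.
Proof.
move=> l0 lD lZ ls.
have lmono x y : cle x y -> l x <= l y by move=> [z ->]; rewrite lD lerDl.
have l00 : l 0 = 0 by rewrite -(scale0r (0 : P)) lZ/= mul0r.
split=> //; split=> // u x iu _ ux.
have [y y0 yu] := cincr_psum iu.
apply/real_lub_cvg; first by apply/nondecreasing_seqP => n; exact: lmono.
have : csum y x.
  apply/lub_csum/is_lubS; first exact: psum_incr.
  by rewrite (_ : (fun n => _) = u)//; apply/funext.
move=> /ls/rsum_natP -/(_ (fun=> l0 _)).
rewrite -(cvg_shiftS (fun N => _)) (_ : (fun N => _) = l \o u)//.
by apply/funext => N /=; rewrite -yu /psum (big_morph l lD l00).
Qed.

Section DualNorm.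
Variables (P : coneType R) (l : P -> R).
Hypotheses (dl : in_dual l) (l1 : forall x, cnorm x <= 1 -> l x <= 1).

Lemma dual_norm_ub : has_ubound [set l x | x in [set x : P | cnorm x <= 1]].
Proof. by exists 1 => _ [x x1 <-]; exact: l1. Qed.

Lemma dual_norm_ge0 : 0 <= dual_norm l.
Proof.
rewrite -(dual0 dl).
by apply: ub_le_sup; [exact: dual_norm_ub|exists 0 => //=; rewrite cnorm0].
Qed.

Lemma dual_norm_le x : l x <= dual_norm l * cnorm x.
Proof.
have := cnorm_ge0 x; rewrite le_eqVlt => /predU1P[/esym/cnorm0_eq0 ->|x0].
  by rewrite dual0// mulr_ge0 ?dual_norm_ge0 ?cnorm_ge0.
have xV : 0 <= (cnorm x)^-1 by rewrite invr_ge0 ltW.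
rewrite -ler_pdivrMr// mulrC -(val_nnr xV) -dualZ//.
apply: ub_le_sup; first exact: dual_norm_ub.
exists (nnr (cnorm x)^-1 *: x) => //=.
by rewrite cnorm_nnr// mulVf// gt_eqF.
Qed.

Lemma dual_norm_pos : l <> (fun=> 0) -> 0 < dual_norm l.
Proof.
move=> m0; rewrite lt_neqAle dual_norm_ge0 andbT; apply/eqP => /esym d0.
apply: m0; apply/funext => x; apply/le_anti.
by rewrite (dual_ge0 dl) (le_trans (dual_norm_le _))// d0 mul0r.
Qed.

End DualNorm.

(** Common part of the norm axiom for the three measurability structures built below. The last
    hypothesis is quantified over [M] so that it can be used with [M] the supremum itself, which is
    0 when there are no nonzero tests. *)
Lemma cnorm_testE P (T : Type) (t : T) (S : set (T -> P -> R)) (x : P) :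
  (forall m, S m -> in_dual (m t)) ->
  (forall m, S m -> forall y, cnorm y <= 1 -> m t y <= 1) ->
  (forall M, 0 <= M -> (forall m, S m -> m t x <= dual_norm (m t) * M) ->
    cnorm x <= M) ->
  cnorm x = sup [set m t x / dual_norm (m t) | m in [set m | S m /\ m t <> (fun=> 0)]].
Proof.
move=> Sd S1 SM; set E := (X in sup X).
have ubE : ubound E (cnorm x).
  move=> _ [m [Sm m0] <-]; rewrite ler_pdivrMr; last exact: dual_norm_pos (Sd _ Sm) (S1 _ Sm) m0.
  by rewrite mulrC; exact: dual_norm_le (Sd _ Sm) (S1 _ Sm) x.
have E0 a : E a -> 0 <= a.
  move=> [m [Sm m0] <-]; rewrite divr_ge0//; first exact: dual_ge0 (Sd _ Sm) x.
  exact: dual_norm_ge0 (Sd _ Sm) (S1 _ Sm).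
apply/le_anti/andP; split; last first.
  have [->|E1] := eqVneq E set0; first by rewrite sup0 cnorm_ge0.
  by apply: ge_sup => //; exact/set0P.
have E0' : 0 <= sup E.
  have [->|/set0P[a Ea]] := eqVneq E set0; first by rewrite sup0.
  by rewrite (le_trans (E0 _ Ea))//; apply: ub_le_sup => //; exists (cnorm x).
apply: SM => // m Sm.
(* Zero tests are left out of the supremum, but the bound is still owed for them. *)
have [m0|m0] := EM (m t = (fun=> 0)).
  by have := dual_norm_ge0 (Sd _ Sm) (S1 _ Sm); rewrite m0 => h; rewrite mulr_ge0.
rewrite mulrC -ler_pdivrMr; last exact: dual_norm_pos (Sd _ Sm) (S1 _ Sm) m0.
by apply: ub_le_sup; [exists (cnorm x)|exists m].
Qed.

End ConeBasics.

(** * Recognising norms, lubs and sums with tests *)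

Section MeasCone.
Context {R : realType} {Ar : arities}.
Implicit Types C D : measurableConeType R Ar.

Lemma mtest_in_dual C m : mtest (ar_one Ar) m -> in_dual (m ar_pt : C -> R).
Proof. by move=> mm; exact: (mtest_dual _ _ mm). Qed.

Lemma mtest_restr C (X : ar_ob Ar) (m : X -> C -> R) (s : X) :
  mtest X m -> mtest (ar_one Ar) (fun=> m s).
Proof. by move=> mm; exact: (mtest_comp _ _ (fun=> s) m (measurable_cst _) mm). Qed.

Lemma mtest_le1 C (m : ar_one Ar -> C -> R) : mtest (ar_one Ar) m ->
  forall x, cnorm x <= 1 -> m ar_pt x <= 1.
Proof. by move=> mm x x1; have [_ /(_ ar_pt)/andP[]] := mtest_meas _ _ mm _ x1. Qed.

Lemma mtest_le C (m : ar_one Ar -> C -> R) x : mtest (ar_one Ar) m ->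
  m ar_pt x <= dual_norm (m ar_pt) * cnorm x.
Proof. by move=> mm; apply: dual_norm_le; [exact: mtest_in_dual|exact: mtest_le1]. Qed.

Lemma dual_norm_gt0 C (m : ar_one Ar -> C -> R) : mtest (ar_one Ar) m ->
  m ar_pt <> (fun=> 0) -> 0 < dual_norm (m ar_pt).
Proof. by move=> mm; apply: dual_norm_pos; [exact: mtest_in_dual|exact: mtest_le1]. Qed.

Lemma cnorm_le C (x : C) (M : R) : 0 <= M ->
  (forall m, mtest (ar_one Ar) m -> m ar_pt x <= dual_norm (m ar_pt) * M) ->
  cnorm x <= M.
Proof.
move=> M0 h; rewrite (mtest_norm (Ar := Ar)).
set S := (X in sup X).
have [->|S0] := eqVneq S set0; first by rewrite sup0.
apply: ge_sup; first exact/set0P.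
move=> _ [m [mm m0] <-]; rewrite ler_pdivrMr ?dual_norm_gt0// mulrC.
exact: h.
Qed.

(** Supplies the norm bound that completeness asks for: each [m (u n)] increases to [m x], and the
    tests determine the norm. *)
Lemma norm_le_of_cvg C (u : nat -> C) (x : C) : cincreasing u ->
  (forall m, mtest (ar_one Ar) m -> m ar_pt \o u @ \oo --> m ar_pt x) ->
  forall n, cnorm (u n) <= cnorm x.
Proof.
move=> iu ux n; apply: cnorm_le; first exact: cnorm_ge0.
move=> m mm; apply: le_trans (mtest_le _ mm).
have ndu := dual_nd (mtest_in_dual mm) iu.
rewrite -(cvg_lim _ (ux _ mm))//.
by apply: (nondecreasing_cvgn_le ndu); exact: cvgP (ux _ mm).
Qed.

(** Completeness gives some lub [y]; the tests are omega-continuous, so they agree on [x] and [y],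
    and they separate points. *)
Lemma lub_weak C (u : nat -> C) (x : C) : cincreasing u ->
  (forall m, mtest (ar_one Ar) m -> m ar_pt \o u @ \oo --> m ar_pt x) ->
  is_lub (@cle R C) u x.
Proof.
move=> iu ux.
have [y uy _] := cone_complete_bnd iu (norm_le_of_cvg iu ux).
suff -> : x = y by [].
apply: (mtest_sep (Ar := Ar)) => m mm.
have dm := mtest_in_dual mm.
by apply: (cvg_unique _ (ux m mm) (dual_lub dm iu uy)).
Qed.

Lemma csum_weak_lub C (y : nat -> C) (x : C) :
  (forall m, mtest (ar_one Ar) m -> rsum (m ar_pt \o y) (m ar_pt x)) ->
  is_lub (@cle R C) (psum y) x.
Proof.
move=> yx; apply: lub_weak; first exact: psum_incr.
move=> m mm; have dm := mtest_in_dual mm.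
have /rsum_natP -/(_ (fun=> dual_ge0 dm _)) := yx m mm.
rewrite (_ : (fun N => _) = m ar_pt \o psum y)//.
by apply/funext => N /=; rewrite dual_sum.
Qed.

(** After pickling the index into [nat], the tests identify [x] as the lub of the partial sums, and
    every functional respects that lub. *)
Lemma csum_weak (K : countType) C (y : K -> C) (x : C) :
  (forall m, mtest (ar_one Ar) m -> rsum (m ar_pt \o y) (m ar_pt x)) ->
  csum y x.
Proof.
move=> yx; pose z n := oapp y 0 (pickle_inv n).
have zy : z \o pickle = y by apply/funext => k; rewrite /z/= pickleK_inv.
have ip : injective (@pickle K) := pcan_inj pickleK_inv.
have z0 k' : (forall k, @pickle K k != k') -> z k' = 0.
  rewrite /z; case E : (pickle_inv k') => [k|]//= /(_ k).
  by rewrite (pickle_inv_Some E) eqxx.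
rewrite -zy; apply/(csum_inj _ ip z0)/lub_csum/csum_weak_lub => m mm.
have dm := mtest_in_dual mm.
apply/(@rsum_inj _ _ _ _ (m ar_pt \o z) _ ip).
  by move=> k' /z0 E; rewrite /= E dual0.
by have := yx m mm; rewrite -zy.
Qed.

Lemma csum_lub C (y : nat -> C) (x : C) : csum y x -> is_lub (@cle R C) (psum y) x.
Proof. by move=> yx; apply: csum_weak_lub => m mm; exact/yx/mtest_in_dual. Qed.

Lemma csum_uniq (K : choiceType) C (y : K -> C) (x x' : C) :
  csum y x -> csum y x' -> x = x'.
Proof.
move=> yx yx'; apply: (mtest_sep (Ar := Ar)) => m mm.
by apply: rsum_uniq (yx _ _) (yx' _ _); exact: mtest_in_dual.
Qed.

Lemma csum_ex C (y : nat -> C) (M : R) : (forall N, cnorm (psum y N) <= M) ->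
  exists2 x, csum y x & cnorm x <= M.
Proof.
move=> /(cone_complete_bnd (@psum_incr _ _ y))[x yx xM].
by exists x => //; exact: lub_csum.
Qed.

Lemma csum_part_le C (y : nat -> C) (x : C) N : csum y x -> cle (psum y N) x.
Proof. by move=> /csum_lub[]. Qed.

Lemma omega_dual (P : coneType R) (Q : coneType R) (f : P -> Q) (l : Q -> R) :
  (forall x y, f (x + y) = f x + f y) ->
  (forall (a : Rnn R) x, f (a *: x) = a *: f x) ->
  omega_continuous (@cle R Q) f -> in_dual l -> in_dual (l \o f).
Proof.
move=> fD fZ [fm fl] dl; split=> [x|x y|a x|]/=.
- exact: dual_ge0.
- by rewrite fD dualD.
- by rewrite fZ dualZ.
split=> [x y /fm|u x iu [M uM] ux]; first exact: dual_le.
case: dl => _ _ _ [_ /(_ (f \o u) (f x))]; apply.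
- by move=> n; exact: fm.
- by exists (cnorm (f x)) => n; apply/cle_norm/fm; case: ux.
- by apply: fl => //; exists M.
Qed.

(** Additivity alone gives monotonicity, because the order is algebraic; lubs are then recognised by
    [lub_weak]. *)
Lemma omega_weak (P : coneType R) C (f : P -> C) :
  (forall x y, f (x + y) = f x + f y) ->
  (forall m, mtest (ar_one Ar) m -> in_dual (m ar_pt \o f)) ->
  omega_continuous (@cle R C) f.
Proof.
move=> fD fd.
have fm x y : cle x y -> cle (f x) (f y) by move=> [z ->]; rewrite fD; exact: cle_addr.
split=> // u x iu _ ux; apply: lub_weak; first by move=> n; exact: fm.
by move=> m /fd dm; exact: (dual_lub dm iu ux).
Qed.

End MeasCone.

(** * Measurable paths and integrals *)

Section Paths.
Context {R : realType} {Ar : arities}.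
Implicit Types C D : measurableConeType R Ar.

Lemma mtest_measT C (X : ar_ob Ar) (m : X -> C -> R) x : mtest X m ->
  measurable_fun [set: X] (fun r => m r x).
Proof.
(* Measurability is given on the unit ball only, so [x] is rescaled; the [+ 1] keeps the factor
   positive when [x] is 0. *)
move=> mm; have c0 : 0 < cnorm x + 1 by rewrite ltr_wpDl// cnorm_ge0.
have cV0 : 0 <= (cnorm x + 1)^-1 by rewrite invr_ge0 ltW.
rewrite (_ : (fun r => m r x) =
    fun r => (cnorm x + 1) * m r (nnr (cnorm x + 1)^-1 *: x)); last first.
  apply/funext => r; rewrite -{1}(scale_nnrK x c0).
  by rewrite (dualZ (mtest_dual _ _ mm r)) val_nnr// ltW.
apply: measurable_funM; first exact: measurable_cst.
apply: (mtest_meas _ _ mm _ _).1.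
by rewrite cnorm_nnr// ler_pdivrMl// mulr1 lerDl.
Qed.

Lemma path_cst C (X : ar_ob Ar) (x : C) : is_path (fun _ : X => x).
Proof.
split=> [|Y m mm]; first by exists (cnorm x).
exact: (measurableT_comp (mtest_measT x mm) measurable_fst).
Qed.

Lemma path_comp C (X Y : ar_ob Ar) (gamma : X -> C) (phi : Y -> X) :
  measurable_fun setT phi -> is_path gamma -> is_path (gamma \o phi).
Proof.
move=> mphi [[M gM] mg]; split=> [|Z m mm]; first by exists M => r; exact: gM.
apply: (measurableT_comp (mg Z m mm) (g := fun p : Z * Y => (p.1, phi p.2))).
apply: measurable_fun_pair; first exact: measurable_fst.
exact: (measurableT_comp mphi measurable_snd).
Qed.

Lemma path_meas C (X Y : ar_ob Ar) (gamma : X -> C) (m : Y -> C -> R) (s : Y) :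
  is_path gamma -> mtest Y m -> measurable_fun setT (fun r => m s (gamma r)).
Proof.
move=> [_ mg] mm; apply: (measurableT_comp (mg Y m mm) (g := fun r => (s, r))).
by apply: measurable_fun_pair => //; exact: measurable_cst.
Qed.

(** Measurability is that of a pointwise limit of partial sums. Boundedness does not follow from
    that of the terms, hence the last hypothesis. *)
Lemma path_csum C (X : ar_ob Ar) (g_ : nat -> X -> C) (gamma : X -> C) :
  (forall k, is_path (g_ k)) -> (forall r, csum (g_^~ r) (gamma r)) ->
  (exists M, forall r, cnorm (gamma r) <= M) -> is_path gamma.
Proof.
move=> pg gs bg; split=> // Y m mm.
apply: (@measurable_fun_cvg _ _ _ _
   (fun N p => \sum_(k < N) m p.1 (g_ k p.2))) => [N|p _].
  by apply: measurable_sum => k; case: (pg k) => _; exact.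
have dm := mtest_dual _ _ mm p.1.
have /rsum_natP := gs p.2 _ dm.
by apply=> k; exact: dual_ge0.
Qed.

Lemma pathD C (X : ar_ob Ar) (g h : X -> C) :
  is_path g -> is_path h -> is_path (fun r => g r + h r).
Proof.
move=> [[M gM] mg] [[N hN] mh]; split=> [|Y m mm].
  by exists (M + N) => r; rewrite (le_trans (ler_cnormD _ _))// lerD.
rewrite (_ : (fun _ => _) = (fun p : Y * X => m p.1 (g p.2) + m p.1 (h p.2))).
  by apply: measurable_funD; [exact: mg|exact: mh].
by apply/funext => p; rewrite (dualD (mtest_dual _ _ mm p.1)).
Qed.

Lemma pathZ C (X : ar_ob Ar) (g : X -> C) (a : Rnn R) :
  is_path g -> is_path (fun r => a *: g r).
Proof.
move=> [[M gM] mg]; split=> [|Y m mm].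
  by exists (val a * M) => r; rewrite cnormZ ler_wpM2l// val_Rnn_ge0.
rewrite (_ : (fun _ => _) = (fun p : Y * X => val a * m p.1 (g p.2))).
  by apply: measurable_funM; [exact: measurable_cst|exact: mg].
by apply/funext => p; rewrite (dualZ (mtest_dual _ _ mm p.1)).
Qed.

Lemma is_integralE C (X Y : ar_ob Ar) (gamma : X -> C)
    (mu : {finite_measure set X -> \bar R}) (x : C) (m : Y -> C -> R) (s : Y) :
  is_integral gamma mu x -> mtest Y m ->
  (m s x)%:E = (\int[mu]_r (m s (gamma r))%:E)%E.
Proof. by move=> gx mm; exact: (gx _ (mtest_restr s mm)). Qed.

Lemma is_integral_uniq C (X : ar_ob Ar) (gamma : X -> C)
    (mu : {finite_measure set X -> \bar R}) (x y : C) :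
  is_integral gamma mu x -> is_integral gamma mu y -> x = y.
Proof.
move=> gx gy; apply: (mtest_sep (Ar := Ar)) => m mm; apply: EFin_inj.
by rewrite gx// gy.
Qed.

(** Monotone convergence, applied test by test. *)
Lemma is_integral_csum C (X : ar_ob Ar) (mu : {finite_measure set X -> \bar R})
    (g_ : nat -> X -> C) (gamma : X -> C) (x_ : nat -> C) (x : C) :
  (forall k, is_path (g_ k)) -> (forall r, csum (g_^~ r) (gamma r)) ->
  (forall k, is_integral (g_ k) mu (x_ k)) -> csum x_ x ->
  is_integral gamma mu x.
Proof.
move=> pg gs gx xs m mm; have dm := mtest_in_dual mm.
have -> := xs _ dm.
rewrite -nneseries_esumT => [|k]; last by rewrite lee_fin dual_ge0.
under eq_integral => r _.
  rewrite (gs r _ dm) -nneseries_esumT => [|k]; last by rewrite lee_fin dual_ge0.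
  over.
rewrite integral_nneseries//=.
- by apply: eq_eseriesr => k _; exact: gx.
- by move=> k; apply/measurable_EFinP; exact: path_meas.
- by move=> k r _; rewrite lee_fin dual_ge0.
Qed.

Lemma is_integralD C (X : ar_ob Ar) (mu : {finite_measure set X -> \bar R})
    (g h : X -> C) (x y : C) : is_path g -> is_path h ->
  is_integral g mu x -> is_integral h mu y ->
  is_integral (fun r => g r + h r) mu (x + y).
Proof.
move=> pg ph gx hy m mm; have dm := mtest_in_dual mm.
rewrite dualD// EFinD gx// hy//.
under [RHS]eq_integral do rewrite dualD// EFinD.
by rewrite ge0_integralD//=; try (by move=> r _; rewrite lee_fin dual_ge0);
   apply/measurable_EFinP; exact: path_meas.
Qed.

(** The subtraction is made after testing, where the integral of [g] is finite because it is the
    value of a test at [x]. *)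
Lemma is_integralD_cancel C (X : ar_ob Ar) (mu : {finite_measure set X -> \bar R})
    (g h : X -> C) (x y : C) : is_path g -> is_path h ->
  is_integral g mu x -> is_integral (fun r => g r + h r) mu (x + y) ->
  is_integral h mu y.
Proof.
move=> pg ph gx ghxy m mm; have dm := mtest_in_dual mm.
have := ghxy m mm; rewrite dualD//.
under eq_integral do rewrite dualD// EFinD.
rewrite ge0_integralD//=; try (by move=> r _; rewrite lee_fin dual_ge0);
  try (by apply/measurable_EFinP; exact: path_meas).
rewrite -gx// EFinD => /(congr1 (fun z => (z - (m ar_pt x)%:E)%E)).
by rewrite addeAC subee// add0e addeAC subee// add0e.
Qed.

Lemma is_integralZ C (X : ar_ob Ar) (mu : {finite_measure set X -> \bar R})
    (g : X -> C) (a : Rnn R) (x : C) : is_path g ->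
  is_integral g mu x -> is_integral (fun r => a *: g r) mu (a *: x).
Proof.
move=> pg gx m mm; have dm := mtest_in_dual mm.
rewrite dualZ// EFinM gx//.
under [RHS]eq_integral do rewrite dualZ// EFinM.
rewrite ge0_integralZl//=.
- by apply/measurable_EFinP; exact: path_meas.
- by move=> r _; rewrite lee_fin dual_ge0.
- by rewrite lee_fin val_Rnn_ge0.
Qed.

End Paths.

(** * Linear and multilinear maps *)

Section Linmap.
Context {R : realType} {Ar : arities}.
Implicit Types A B C D : integrableConeType R Ar.

Lemma csumD (K : choiceType) C (y z : K -> C) (x x' : C) :
  csum y x -> csum z x' -> csum (fun k => y k + z k) (x + x').
Proof.
move=> yx zx l dl; rewrite dualD//.
have := rsumD (fun=> dual_ge0 dl _) (fun=> dual_ge0 dl _) (yx l dl) (zx l dl).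
by apply: eq_rsum => k /=; rewrite dualD.
Qed.

(** What [in_Sym] imposes on one argument, together with preservation of paths; the latter is what
    lets integral preservation compose. *)
Record linmap B C (f : B -> C) : Prop := Linmap {
  lm_linear : linear_map f;
  lm_cont : omega_continuous (@cle R C) f;
  lm_int : integral_preserving f;
  lm_path : forall (X : ar_ob Ar) (g : X -> B), is_path g -> is_path (f \o g)
}.

Section LinmapTheory.
Variables (B C : integrableConeType R Ar) (f : B -> C).
Hypothesis lf : linmap f.

Lemma linmapD x y : f (x + y) = f x + f y.
Proof. exact: (lm_linear lf).1. Qed.
Lemma linmapZ (a : Rnn R) x : f (a *: x) = a *: f x.
Proof. exact: (lm_linear lf).2. Qed.
Lemma linmap0 : f 0 = 0.
Proof. by rewrite -(scale0r (0 : B)) linmapZ scale0r. Qed.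
Lemma linmap_le x y : cle x y -> cle (f x) (f y).
Proof. by move=> [z ->]; rewrite linmapD; exact: cle_addr. Qed.
Lemma linmap_dual (l : C -> R) : in_dual l -> in_dual (l \o f).
Proof. by apply: omega_dual; [exact: linmapD|exact: linmapZ|exact: lm_cont]. Qed.
Lemma linmap_csum (K : choiceType) (y : K -> B) x : csum y x -> csum (f \o y) (f x).
Proof. by move=> yx l dl; exact: (yx _ (linmap_dual dl)). Qed.
End LinmapTheory.

Lemma linmap_comp A B C (g : B -> C) (f : A -> B) :
  linmap g -> linmap f -> linmap (g \o f).
Proof.
move=> lg lf; split.
- by split=> [x y|a x] /=; rewrite ?(linmapD lf) ?(linmapZ lf) ?(linmapD lg) ?(linmapZ lg).
- apply: omega_weak => [x y|m mm] /=; first by rewrite (linmapD lf) (linmapD lg).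
  by apply: (linmap_dual lf (l := m ar_pt \o g)); apply: linmap_dual => //; exact: mtest_in_dual.
- move=> X g0 pg0 mu x ix; apply: (lm_int lg (gamma := f \o g0)); first exact: lm_path.
  exact: lm_int.
- by move=> X g0 pg0; apply: (lm_path lg (g := f \o g0)); exact: lm_path.
Qed.

Lemma linmap_id B : linmap (@id B).
Proof.
by split.
Qed.

Lemma linmap_zero B C : linmap (fun _ : B => 0 : C).
Proof.
split.
- by split=> *; rewrite ?addr0 ?scaler0.
- apply: omega_weak => [*|m mm]; first by rewrite addr0.
  have dm := mtest_in_dual mm.
  apply: in_dual_sigma => *; rewrite /= ?dual0 ?addr0 ?mulr0//.
  by apply: eq_rsum (rsum0 _) => k /=; rewrite dual0.
- move=> X g pg mu x _ m mm; have dm := mtest_in_dual mm.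
  by under eq_integral do rewrite dual0//; rewrite integral0 dual0.
- by move=> X g _; exact: path_cst.
Qed.

Lemma linmap_scale C (a : Rnn R) : linmap (fun x : C => a *: x).
Proof.
have D (x y : C) : a *: (x + y) = a *: x + a *: y by rewrite scalerDr.
split.
- by split=> // l x; rewrite !scalerA mulrC.
- apply: omega_weak => // m mm; have dm := mtest_in_dual mm.
  apply: in_dual_sigma => [x|x y|b x|y x yx] /=.
  + exact: dual_ge0.
  + by rewrite D dualD.
  + by rewrite !dualZ// mulrCA.
  + rewrite dualZ//.
    apply: eq_rsum (rsumZ (val_Rnn_ge0 a) (fun=> dual_ge0 dm _) (yx _ dm)) => k /=.
    by rewrite dualZ.
- by move=> X g pg mu x ix; exact: is_integralZ.
- by move=> X g pg; exact: pathZ.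
Qed.

Definition slice B C (I : finType) (h : (I -> B) -> C) (i : I) (v : I -> B) : B -> C :=
  fun x => h (@dfwith _ (fun=> B) v i x).

Lemma slice_path B C (I : finType) (h : (I -> B) -> C) i v :
  (forall (X : ar_ob Ar) (beta : I -> X -> B), (forall i, is_path (beta i)) ->
    is_path (fun r => h (fun i => beta i r))) ->
  forall (X : ar_ob Ar) (g : X -> B), is_path g -> is_path (slice h i v \o g).
Proof.
move=> hp X g pg.
rewrite (_ : _ \o g = fun r => h (fun j => @dfwith _ (fun=> X -> B) (fun j _ => v j) i g j r)).
  by apply: hp => j; case: dfwithP => // k _; exact: path_cst.
apply/funext => r /=; congr h; apply/funext => j.
by case: dfwithP => [|k ik]; rewrite ?dfwithin// dfwithout.
Qed.

Record multi B C (I : finType) (h : (I -> B) -> C) : Prop := Multi {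
  m_slice : forall i v, linmap (slice h i v);
  m_path : forall (X : ar_ob Ar) (beta : I -> X -> B),
    (forall i, is_path (beta i)) -> is_path (fun r => h (fun i => beta i r))
}.

Lemma in_SymP B C n (h : ('I_n -> B) -> C) :
  in_Sym h <-> multi h /\ forall (s : 'S_n) v, h (v \o s) = h v.
Proof.
split=> [[hl hc hs hm hi]|[[hs hp] hsym]]; last first.
  by split=> // i v; have [] := hs i v.
split=> //; split=> // i v.
by apply: Linmap; [exact: hl|exact: hc|exact: hi|exact: slice_path].
Qed.

Lemma slice_csum B C (I : finType) (h : (I -> B) -> C) i v (K : choiceType) (y : K -> B) x :
  multi h -> csum y x -> csum (fun k => slice h i v (y k)) (slice h i v x).
Proof. by move=> mh; exact: (linmap_csum (m_slice mh i v)). Qed.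

(** Omega-continuity of the sum is an exchange of two countable sums, and integral preservation is
    monotone convergence. The bound in the last hypothesis is there because paths have to be
    bounded. *)
Lemma multi_csum B C (I : finType) (h_ : nat -> (I -> B) -> C) (h : (I -> B) -> C) :
  (forall k, multi (h_ k)) -> (forall v, csum (h_^~ v) (h v)) ->
  (forall K, exists M, forall v, (forall i, cnorm (v i) <= K) -> cnorm (h v) <= M) ->
  multi h.
Proof.
move=> mh hs hb.
have hp (X : ar_ob Ar) (beta : I -> X -> B) : (forall i, is_path (beta i)) ->
    is_path (fun r => h (fun i => beta i r)).
  move=> pb; apply: (path_csum (g_ := fun k r => h_ k (fun i => beta i r))).
  - by move=> k; exact: m_path.
  - by move=> r; exact: hs.
  - have /choice[K bK] : forall i, exists K, forall r, cnorm (beta i r) <= K.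
      by move=> i; case: (pb i).
    have [M hM] := hb (\sum_i `|K i|); exists M => r; apply: hM => i.
    rewrite (le_trans (bK i r))// (le_trans (ler_norm _))// (bigD1 i)//= lerDl.
    by rewrite sumr_ge0.
split=> // i v.
have D x y : slice h i v (x + y) = slice h i v x + slice h i v y.
  apply: csum_uniq (hs _) _; apply: eq_csum (csumD (hs _) (hs _)) => k /=.
  by rewrite -[RHS]/(slice (h_ k) i v (x + y)) (linmapD (m_slice (mh k) i v)).
have Z (a : Rnn R) x : slice h i v (a *: x) = a *: slice h i v x.
  apply: csum_uniq (hs _) _.
  apply: eq_csum (linmap_csum (linmap_scale _ a) (hs (@dfwith _ (fun=> B) v i x))) => k /=.
  by rewrite -[RHS]/(slice (h_ k) i v (a *: x)) (linmapZ (m_slice (mh k) i v)).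
split=> //.
- apply: omega_weak => // m mm; have dm := mtest_in_dual mm.
  apply: in_dual_sigma => [x|x y|a x|y x yx] /=.
  + exact: dual_ge0.
  + by rewrite D dualD.
  + by rewrite Z dualZ.
  + apply/(@rsum_swap _ _ _ (fun k j => m ar_pt (slice (h_ k) i v (y j)))
      (fun k => m ar_pt (slice (h_ k) i v x))).
    * by move=> *; exact: dual_ge0.
    * by move=> k; exact: (slice_csum i v (mh k) yx dm).
    * by move=> j; exact: (hs (@dfwith _ (fun=> B) v i (y j)) _ dm).
    * exact: (hs (@dfwith _ (fun=> B) v i x) _ dm).
- move=> X g pg mu x ix.
  apply: (@is_integral_csum _ _ _ _ _ (fun k => slice (h_ k) i v \o g) _
    (fun k => slice (h_ k) i v x)).
  + by move=> k; apply: lm_path => //; exact: m_slice.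
  + by move=> r; exact: hs.
  + by move=> k; apply: lm_int => //; exact: m_slice.
  + exact: hs.
- exact: slice_path.
Qed.

End Linmap.

(** * Calculus of multilinear maps *)

Section MultiTheory.
Context {R : realType} {Ar : arities}.
Implicit Types A B C D : integrableConeType R Ar.

Lemma dfwithE (I : eqType) (T : Type) (v : I -> T) i x j :
  dfwith v i x j = if i == j then x else v j.
Proof. by case: dfwithP => [|k /negPf->]; rewrite ?eqxx. Qed.

Lemma dfwith_id (I : eqType) (T : Type) (v : I -> T) i : dfwith v i (v i) = v.
Proof. by apply/funext => j; rewrite dfwithE; case: eqP => // <-. Qed.

Lemma multi_post B C D (I : finType) (q : C -> D) (h : (I -> B) -> C) :
  linmap q -> multi h -> multi (q \o h).
Proof.
move=> lq mh; split=> [i v|X b pb].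
  exact: (linmap_comp lq (m_slice mh i v)).
exact: (lm_path lq (m_path mh pb)).
Qed.

(** Bijectivity matters: a repeated argument would make the map quadratic, a dropped one would make
    it constant in that argument. *)
Lemma multi_reind B C (I I' : finType) (e : I -> I') (h : (I -> B) -> C) :
  bijective e -> multi h -> multi (fun v => h (v \o e)).
Proof.
move=> [e' eK e'K] mh; split=> [i v|X b pb].
  rewrite (_ : slice _ i v = slice h (e' i) (v \o e)); first exact: m_slice.
  apply/funext => x; rewrite /slice/=; congr h; apply/funext => j /=.
  by rewrite !dfwithE (can2_eq e'K eK).
exact: (m_path mh (beta := fun i => b (e i))).
Qed.

(** The argument [(i, j)] occurs only in the inner map [f i], so a slice of the composite is a
    composite of two slices. *)
Lemma multi_comp B C D (I : finType) (J : I -> finType) (g : (I -> C) -> D)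
    (f : forall i, (J i -> B) -> C) :
  multi g -> (forall i, multi (f i)) ->
  multi (fun v : {i : I & J i} -> B => g (fun i => f i (fun j => v (Tagged J j)))).
Proof.
move=> mg mf; split=> [[i j] v|X b pb]; last first.
  by apply: (m_path mg (beta := fun i r => _)) => i; exact: (m_path (mf i)).
rewrite (_ : slice _ _ v =
  slice g i (fun i => f i (fun j => v (Tagged J j))) \o slice (f i) j (fun j => v (Tagged J j))).
  by apply: linmap_comp; exact: m_slice.
apply/funext => x; rewrite /slice/=; congr g; apply/funext => i' /=.
rewrite dfwithE; case: (eqVneq i i') => [<-|ii'].
  congr (f i); apply/funext => j'; rewrite !dfwithE.
  by rewrite -tag_eqE /tag_eq eqxx /= tagged_asE.
congr (f i'); apply/funext => j'; rewrite dfwithE.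
by rewrite -tag_eqE /tag_eq /= (negPf ii').
Qed.

Lemma multi_cst B C (I : finType) (c : C) : #|I| = 0%N -> multi (fun _ : I -> B => c).
Proof.
by move=> /card0_eq I0; split=> [i|X b _]; [have := I0 i|exact: path_cst].
Qed.

Lemma multi_lin B C (f : B -> C) : linmap f -> multi (fun v : unit -> B => f (v tt)).
Proof.
move=> lf; split=> [[] v|X b pb]; last exact: (lm_path lf (pb tt)).
by rewrite (_ : slice _ _ _ = f)//; apply/funext => x; rewrite /slice dfwithE.
Qed.

Lemma multi_zero B C (I : finType) : multi (fun _ : I -> B => 0 : C).
Proof. by split=> [i v|X b _]; [exact: linmap_zero|exact: path_cst]. Qed.

Lemma linmapDm B C (f g : B -> C) : linmap f -> linmap g -> linmap (fun x => f x + g x).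
Proof.
move=> lf lg; split.
- split=> [x y|a x]; first by rewrite (linmapD lf) (linmapD lg) addrACA.
  by rewrite (linmapZ lf) (linmapZ lg) scalerDr.
- apply: omega_weak => [x y|m mm].
    by rewrite (linmapD lf) (linmapD lg) addrACA.
  have dm := mtest_in_dual mm.
  apply: in_dual_sigma => [x|x y|b x|y x yx] /=.
  + exact: dual_ge0.
  + by rewrite (linmapD lf) (linmapD lg) addrACA dualD.
  + by rewrite (linmapZ lf) (linmapZ lg) -scalerDr dualZ.
  + exact: (csumD (linmap_csum lf yx) (linmap_csum lg yx) dm).
- move=> X b pb mu x ix; apply: is_integralD; try exact: lm_path.
  + exact: (lm_int lf).
  + exact: (lm_int lg).
- by move=> X b pb; apply: pathD; exact: lm_path.
Qed.

Lemma multiD B C (I : finType) (f g : (I -> B) -> C) :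
  multi f -> multi g -> multi (fun v => f v + g v).
Proof.
move=> mf mg; split=> [i v|X b pb].
  exact: (linmapDm (m_slice mf i v) (m_slice mg i v)).
by apply: pathD; exact: m_path.
Qed.

Lemma multi_sum B C (I : finType) (J : Type) (s : seq J) (h : J -> (I -> B) -> C) :
  (forall j, multi (h j)) -> multi (fun v => \sum_(j <- s) h j v).
Proof.
move=> mh; elim: s => [|j s IH].
  by under eq_fun do rewrite big_nil; exact: multi_zero.
by under eq_fun do rewrite big_cons; exact: multiD.
Qed.

(** Linearity follows by cancelling [g] inside [C]. For omega-continuity and integrals the
    subtraction takes place among reals, after testing. *)
Lemma linmap_diff B C (f g h : B -> C) : (forall x, f x = g x + h x) ->
  linmap f -> linmap g ->
  (forall (X : ar_ob Ar) (b : X -> B), is_path b -> is_path (h \o b)) -> linmap h.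
Proof.
move=> fE lf lg hp.
have hD x y : h (x + y) = h x + h y.
  apply: (@cone_addrI _ _ (g (x + y))).
  by rewrite -fE (linmapD lf) !fE (linmapD lg) addrACA.
have hZ (a : Rnn R) x : h (a *: x) = a *: h x.
  apply: (@cone_addrI _ _ (g (a *: x))).
  by rewrite -fE (linmapZ lf) fE (linmapZ lg) scalerDr.
split=> //.
- apply: omega_weak => // m mm; have dm := mtest_in_dual mm.
  apply: in_dual_sigma => [x|x y|b x|y x yx] /=.
  + exact: dual_ge0.
  + by rewrite hD dualD.
  + by rewrite hZ dualZ.
  have /rsum_natP -/(_ (fun=> dual_ge0 dm _)) cf := linmap_csum lf yx dm.
  have /rsum_natP -/(_ (fun=> dual_ge0 dm _)) cg := linmap_csum lg yx dm.
  apply/rsum_natP => [k|]; first exact: (dual_ge0 dm).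
  have -> : m ar_pt (h x) = m ar_pt (f x) - m ar_pt (g x).
    by rewrite fE dualD// addrC addKr.
  rewrite (_ : (fun N => _) = fun N => \sum_(k < N) (m ar_pt \o (f \o y)) k -
      \sum_(k < N) (m ar_pt \o (g \o y)) k); first exact: (cvgB cf cg).
  apply/funext => N /=; rewrite -sumrB; apply: eq_bigr => k _ /=.
  by rewrite fE dualD// addrC addKr.
- move=> X b pb mu x ix.
  apply: (@is_integralD_cancel _ _ _ _ _ (g \o b) (h \o b) (g x)).
  + exact: lm_path.
  + exact: hp.
  + exact: (lm_int lg).
  + by rewrite -fE (_ : (fun r => _) = f \o b); [exact: (lm_int lf)|apply/funext => r /=; rewrite fE].
Qed.

Lemma path_diff C (X : ar_ob Ar) (f g h : X -> C) : (forall x, f x = g x + h x) ->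
  is_path f -> is_path g -> is_path h.
Proof.
move=> fE [[M fM] mf] [_ mg]; split=> [|Y m mm].
  by exists M => r; rewrite (le_trans _ (fM r))// fE addrC ler_cnormDr.
rewrite (_ : (fun _ => _) = (fun p : Y * X => m p.1 (f p.2) - m p.1 (g p.2))).
  by apply: measurable_funB; [exact: mf|exact: mg].
by apply/funext => p; rewrite fE (dualD (mtest_dual _ _ mm p.1)) addrC addKr.
Qed.

Lemma multi_diff B C (I : finType) (f g h : (I -> B) -> C) :
  (forall v, f v = g v + h v) -> multi f -> multi g -> multi h.
Proof.
move=> fE mf mg.
have hp (X : ar_ob Ar) (b : I -> X -> B) : (forall i, is_path (b i)) ->
    is_path (fun r => h (fun i => b i r)).
  move=> pb; apply: (@path_diff _ _ (fun r => f (fun i => b i r)) (fun r => g (fun i => b i r))).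
  - by move=> r; rewrite fE.
  - exact: m_path.
  - exact: m_path.
split=> // i v; apply: (@linmap_diff _ _ (slice f i v) (slice g i v)).
- by move=> x; exact: fE.
- exact: m_slice.
- exact: m_slice.
- move=> X b pb; apply: (@path_diff _ _ (slice f i v \o b) (slice g i v \o b)).
  + by move=> r /=; exact: fE.
  + exact: (lm_path (m_slice mf i v)).
  + exact: (lm_path (m_slice mg i v)).
Qed.

Lemma multi_le B C (I : finType) (h : (I -> B) -> C) v w : multi h ->
  (forall i, cle (v i) (w i)) -> cle (h v) (h w).
Proof.
move=> mh vw.
(* The arguments are raised from [v] to [w] one at a time along a list; [enum I] then gives the
   claim. *)
suff H (s : seq I) : cle (h v) (h (fun i => if i \in s then w i else v i)).
  have := H (enum I); congr (cle _ (h _)).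
  by apply/funext => i; rewrite mem_enum.
elim: s => [|i s IH]; first exact: cle_refl.
apply: cle_trans IH _.
set u := fun j => if j \in s then w j else v j.
rewrite -(dfwith_id u i) (_ : (fun j => _) = dfwith u i (w i)).
  apply: (linmap_le (m_slice mh i u)).
  by rewrite /u; case: ifP => // _; exact: cle_refl.
apply/funext => j; rewrite dfwithE inE eq_sym.
by case: eqP => //= <-.
Qed.

Lemma multi_homog B C (I : finType) (h : (I -> B) -> C) (a : Rnn R) v : multi h ->
  h (fun i => a *: v i) = a ^+ #|I| *: h v.
Proof.
move=> mh.
suff H (s : seq I) : uniq s ->
    h (fun i => if i \in s then a *: v i else v i) = a ^+ size s *: h v.
  rewrite cardE -H ?enum_uniq//; congr h.
  by apply/funext => i; rewrite mem_enum.
elim: s => [|i s IH] /=; first by rewrite expr0 scale1r.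
move=> /andP[nis us]; rewrite exprS -scalerA -IH//.
set u := fun j => if j \in s then a *: v j else v j.
have ui : u i = v i by rewrite /u (negPf nis).
rewrite -[X in a *: h X](dfwith_id u i) -[RHS](linmapZ (m_slice mh i u)) /slice ui.
congr h; apply/funext => j; rewrite dfwithE inE eq_sym.
by case: eqP => //= <-.
Qed.

Lemma cnorm_sum C (I : finType) (v : I -> C) : cnorm (\sum_i v i) <= \sum_i cnorm (v i).
Proof.
elim/big_rec2: _ => [|i x y _ IH]; first by rewrite cnorm0.
by rewrite (le_trans (ler_cnormD _ _))// lerD2l.
Qed.

(** A bound on the diagonal controls all arguments: each [v i] lies below the sum of all of them,
    and [h] is monotone. The base of the power is a scale that brings this sum into the unit ball,
    with [+ 1] to keep it positive. *)
Lemma multi_bound B C (I : finType) (h : (I -> B) -> C) (M K : R) v : multi h ->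
  (forall x, cnorm x <= 1 -> cnorm (h (fun=> x)) <= M) ->
  (forall i, cnorm (v i) <= K) ->
  cnorm (h v) <= (#|I|%:R * `|K| + 1) ^+ #|I| * M.
Proof.
move=> mh hM vK; set c := (_ + 1).
have c0 : 0 < c by rewrite ltr_wpDl// mulr_ge0// ler0n.
have cV0 : 0 <= c^-1 by rewrite invr_ge0 ltW.
have vs i : cle (v i) (\sum_i v i) by rewrite (bigD1 i)//=; exact: cle_addr.
apply: le_trans (cle_norm (multi_le mh vs)) _.
rewrite -(scale_nnrK (\sum_i v i) c0) multi_homog// cnormZ.
rewrite (_ : val (_ ^+ _) = c ^+ #|I|); last by rewrite rmorphXn/= val_nnr// ltW.
apply: ler_wpM2l; [exact/exprn_ge0/ltW|apply: hM].
rewrite cnorm_nnr// ler_pdivrMl// mulr1 (le_trans (cnorm_sum _))//.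
rewrite (@le_trans _ _ (#|I|%:R * `|K|)) ?lerDl//.
rewrite mulr_natl -sumr_const [leRHS](eq_bigl xpredT)//.
by apply: ler_sum => i _; rewrite (le_trans (vK i))// ler_norm.
Qed.

(** An average rather than a sum, so that the diagonal is unchanged. *)
Definition symz B C n (h : ('I_n -> B) -> C) (v : 'I_n -> B) : C :=
  nnr (n`!%:R^-1) *: \sum_(s : 'S_n) h (v \o s).

Lemma symz_multi B C n (h : ('I_n -> B) -> C) : multi h -> multi (symz h).
Proof.
move=> mh; apply: (multi_post (linmap_scale _ _)); apply: multi_sum => s.
by apply: multi_reind => //; exists (s^-1)%g; [exact: permK|exact: permKV].
Qed.

Lemma symz_sym B C n (h : ('I_n -> B) -> C) (s : 'S_n) v : symz h (v \o s) = symz h v.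
Proof.
rewrite /symz; congr (_ *: _).
rewrite [RHS](reindex_inj (mulIg s)) /=; apply: eq_bigr => t _; congr h.
by apply/funext => i /=; rewrite permM.
Qed.

Lemma scale_natr C k (x : C) : x *+ k = (k%:R : Rnn R) *: x.
Proof.
elim: k => [|k IH]; first by rewrite scale0r.
by rewrite mulrS IH -[in RHS]natr1 scalerDl scale1r addrC.
Qed.

Lemma val_natr k : val (k%:R : Rnn R) = k%:R.
Proof. by rewrite rmorph_nat. Qed.

Lemma symz_diag B C n (h : ('I_n -> B) -> C) x : symz h (fun=> x) = h (fun=> x).
Proof.
rewrite /symz (eq_bigr (fun=> h (fun=> x)))// sumr_const card_Sn scale_natr scalerA.
rewrite (_ : nnr _ * _ = 1) ?scale1r//; apply/val_inj => /=.
by rewrite val_nnr ?invr_ge0// val_natr mulVf// pnatr_eq0 -lt0n fact_gt0.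
Qed.

End MultiTheory.

(** * Analytic functions and their coefficients *)

Section Coefs.
Context {R : realType} {Ar : arities}.
Implicit Types A B C D : integrableConeType R Ar.

Definition has_coefs B C (f : uball B -> C) (h : forall n, ('I_n -> B) -> C) : Prop :=
  (forall n, in_Sym (h n)) /\
  forall x : uball B, csum (fun n => h n (fun=> \val x)) (f x).

Lemma analyticP B C (f : uball B -> C) : analytic f <->
  (exists M : R, forall x, cnorm (f x) <= M) /\ exists h, has_coefs f h.
Proof.
split=> [[fb [h hs hx]]|[fb [h [hs hx]]]]; split=> //; exists h => //.
  by split=> // x; exact/lub_csum/hx.
by move=> x; exact: (csum_lub (hx x)).
Qed.

Lemma has_coefs_multi B C (f : uball B -> C) h n : has_coefs f h -> multi (h n).
Proof. by move=> [/(_ n)/in_SymP[]]. Qed.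

Lemma rsum_fin_le (J : finType) (K : choiceType) (e : J -> K) (a : K -> R) s :
  injective e -> (forall k, 0 <= a k) -> rsum a s -> \sum_j a (e j) <= s.
Proof.
move=> ie a0 as_; pose a' k := if k \in codom e then a k else 0.
have /(rsum_inj _ ie)/= : rsum (a' \o e) (\sum_j a (e j)).
  apply: eq_rsum (rsum_fin (fun=> a0 _)) => j.
  by rewrite /a'/= codom_f.
have h k' : (forall k, e k != k') -> a' k' = 0.
  by move=> ne; rewrite /a'; case: ifPn => // /codomP[j k'E]; have := ne j; rewrite k'E eqxx.
move=> /(_ h) a's; rewrite -lee_fin a's as_; apply: le_esum => k _.
by rewrite lee_fin /a'; case: ifP.
Qed.

(** Bounds a finite piece of an expansion, such as one homogeneous part, by the whole. *)
Lemma csum_fin_norm (J : finType) (K : choiceType) (e : J -> K) C (y : K -> C) x :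
  injective e -> csum y x -> cnorm (\sum_j y (e j)) <= cnorm x.
Proof.
move=> ie yx; apply: cnorm_le => [|m mm]; first exact: cnorm_ge0.
have dm := mtest_in_dual mm.
rewrite (le_trans _ (mtest_le _ mm))// dual_sum//.
exact: (rsum_fin_le ie (fun=> dual_ge0 dm _) (yx _ dm)).
Qed.

Lemma csum_norm C (y : nat -> C) x M :
  (forall N, cnorm (psum y N) <= M) -> csum y x -> cnorm x <= M.
Proof. by move=> /csum_ex[z yz zM] yx; rewrite (csum_uniq yx yz). Qed.

(** Regrouping by degree. Finitely many terms of degree [n] add up on the diagonal to at most [M],
    hence are bounded everywhere by [multi_bound]; so the sum over [k] exists off the diagonal as
    well, and it is multilinear by [multi_csum]. *)
Lemma coefs_double_sum B C (f : uball B -> C) (M : R)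
    (psi : forall n, nat -> ('I_n -> B) -> C) :
  (forall x, cnorm (f x) <= M) -> (forall n k, in_Sym (psi n k)) ->
  (forall x : uball B, csum (fun p : nat * nat => psi p.1 p.2 (fun=> \val x)) (f x)) ->
  exists2 h, has_coefs f h & forall n v, csum (psi n ^~ v) (h n v).
Proof.
move=> fM spsi psif.
have mpsi n k : multi (psi n k) by have /in_SymP[] := spsi n k.
have bd n N (K : R) (v : 'I_n -> B) : (forall i, cnorm (v i) <= K) ->
    cnorm (psum (psi n ^~ v) N) <= (#|'I_n|%:R * `|K| + 1) ^+ #|'I_n| * M.
  move=> vK; rewrite /psum; apply: (@multi_bound _ _ B C _ (fun v => \sum_(k < N) psi n k v)) => //.
    exact: multi_sum.
  move=> x x1; pose x' : uball B := exist _ x x1.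
  apply: le_trans (fM x').
  by apply: (csum_fin_norm (e := fun k : 'I_N => (n, k : nat)) _ (psif x')) => j k [] /val_inj.
have /choice[h hP] : forall nv : {n & 'I_n -> B}, exists y,
    csum (psi (tag nv) ^~ (tagged nv)) y.
  move=> [n v]/=; have vK i : cnorm (v i) <= \sum_i cnorm (v i).
    by rewrite (bigD1 i)//= lerDl sumr_ge0// => *; exact: cnorm_ge0.
  by have [y yv _] := csum_ex (fun N => bd n N _ v vK); exists y.
pose g n v := h (existT _ n v).
have gP n v : csum (psi n ^~ v) (g n v) by exact: (hP (existT _ n v)).
exists g => //; split=> [n|x].
  apply/in_SymP; split.
    apply: (@multi_csum _ _ _ _ _ (psi n)) => // K; eexists => v vK.
    by apply: csum_norm (gP n v) => N; exact: bd vK.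
  move=> s v; apply: csum_uniq (gP n _) _; apply: eq_csum (gP n v) => k.
  by have /in_SymP[_ hs] := spsi n k; rewrite hs.
move=> l dl; apply/(rsum_pair (a := fun n k => l (psi n k (fun=> \val x)))).
- by move=> *; exact: dual_ge0.
- by move=> n; exact: (gP n _ _ dl).
- exact: (psif x _ dl).
Qed.

(** The general criterion for analyticity: term [j] has degree [#|I j|], whatever its index type. It
    is renumbered by ['I_n], symmetrised without changing its diagonal, and handed to
    [coefs_double_sum]. *)
Lemma analytic_sum B C (f : uball B -> C) (M : R) (J : countType) (I : J -> finType)
    (phi : forall j, (I j -> B) -> C) :
  (forall x, cnorm (f x) <= M) -> (forall j, multi (phi j)) ->
  (forall x : uball B, csum (fun j => phi j (fun=> \val x)) (f x)) ->
  analytic f.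
Proof.
move=> fM mphi phif.
pose th n j (v : 'I_n -> B) : C := if #|I j| =P n is ReflectT e then
  symz (fun w => phi j (fun i => w (cast_ord e (enum_rank i)))) v else 0.
pose psi n k (v : 'I_n -> B) : C := oapp (fun j => th n j v) 0 (pickle_inv k : option J).
have zsym n : in_Sym (fun _ : 'I_n -> B => 0 : C).
  by apply/in_SymP; split=> //; exact: multi_zero.
have spsi n k : in_Sym (psi n k).
  rewrite /psi; case: (pickle_inv k) => [j|//]; rewrite /= /th.
  case: eqP => [e|//]; apply/in_SymP; split=> [|s v]; last exact: symz_sym.
  apply: symz_multi.
  apply: (multi_reind (e := fun i => cast_ord e (enum_rank i))) => //.
  exists (fun i => enum_val (cast_ord (esym e) i)) => i.
    by rewrite cast_ordK enum_rankK.
  by rewrite enum_valK cast_ordKV.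
apply/analyticP; split; first by exists M.
have [|h hc _] := coefs_double_sum fM spsi; last by exists h.
(* Term [j] sits in row [#|I j|] and column [pickle j]; every other entry of the double family is
   0. *)
move=> x; pose e j := (#|I j|, pickle j).
apply/(@csum_inj _ J _ e).
- by move=> i j [_ /(pcan_inj pickleK_inv)].
- move=> [n k] ne; rewrite /psi/=; case E : (pickle_inv k) => [j|]//=.
  rewrite /th; case: eqP => // ej; suff /eqP : e j = (n, k) by rewrite (negPf (ne j)).
  by rewrite /e ej (pickle_inv_Some E).
- apply: eq_csum (phif x) => j; rewrite /psi/= pickleK_inv/= /th.
  by case: eqP => // e'; rewrite symz_diag.
Qed.

(** * The multinomial expansion *)

Definition fcons n (T : Type) (a : T) (w : 'I_n -> T) (i : 'I_n.+1) : T :=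
  oapp w a (unlift ord0 i).

Lemma fcons0 n T (a : T) (w : 'I_n -> T) : fcons a w ord0 = a.
Proof. by rewrite /fcons unlift_none. Qed.

Lemma fconsS n T (a : T) (w : 'I_n -> T) i : fcons a w (lift ord0 i) = w i.
Proof. by rewrite /fcons liftK. Qed.

Lemma fconsP n T (a : T) (w : 'I_n -> T) (v : 'I_n.+1 -> T) :
  v ord0 = a -> (forall i, v (lift ord0 i) = w i) -> fcons a w = v.
Proof.
move=> va vw; apply/funext => i; case: (unliftP ord0 i) => [j|] ->.
  by rewrite fconsS.
by rewrite fcons0.
Qed.

(** Induction on [n]: the functional in the first argument is expanded over [y ord0], the induction
    hypothesis is used with that argument frozen, and Tonelli merges the two sums. [F] takes real
    values so that freezing an argument keeps it in the same class. *)
Lemma multi_expand (P : coneType R) (K : choiceType) n (F : ('I_n -> P) -> R)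
    (y : 'I_n -> K -> P) (x : 'I_n -> P) :
  (forall v, 0 <= F v) ->
  (forall i v, in_dual (fun z => F (dfwith v i z))) ->
  (forall i, csum (y i) (x i)) ->
  rsum (fun s : {ffun 'I_n -> K} => F (fun i => y i (s i))) (F x).
Proof.
elim: n F y x => [|n IH] F y x F0 dF yx.
  pose s0 : {ffun 'I_0 -> K} := ffun0 (card_ord 0).
  have -> : F x = (fun s : {ffun 'I_0 -> K} => F (fun i => y i (s i))) s0.
    by congr F; apply/funext; case.
  apply: rsum_single => // s /eqP[]; apply/ffunP; by case.
have xE : F x = F (dfwith x ord0 (x ord0)) by rewrite dfwith_id.
have := yx ord0 _ (dF ord0 x); rewrite -xE.
have fE k : dfwith x ord0 (y ord0 k) = fcons (y ord0 k) (fun i => x (lift ord0 i)).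
  by apply/esym/fconsP => [|i]; rewrite dfwithE.
have IHk k := IH (fun w => F (fcons (y ord0 k) w)) (fun i => y (lift ord0 i))
   (fun i => x (lift ord0 i)) (fun=> F0 _).
have {}IHk k : rsum (fun s : {ffun 'I_n -> K} =>
    F (fcons (y ord0 k) (fun i => y (lift ord0 i) (s i))))
    (F (dfwith x ord0 (y ord0 k))).
  rewrite fE; apply: IHk => [i v|i]; last exact: yx.
  rewrite (_ : (fun z => _) = fun z => F (dfwith (fcons (y ord0 k) v) (lift ord0 i) z)); first exact: dF.
  apply/funext => z; congr F; apply: fconsP => [|j]; rewrite dfwithE.
    by rewrite eq_sym (negPf (neq_lift _ _)) fcons0.
  by rewrite dfwithE (inj_eq (lift_inj (h := ord0))) fconsS.
move=> /(rsum_pair _ (fun _ _ => F0 _) IHk).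
pose e (p : K * {ffun 'I_n -> K}) : {ffun 'I_n.+1 -> K} := [ffun i => fcons p.1 p.2 i].
move=> H; apply/(@rsum_inj _ _ _ e).
- move=> [k s] [k' s'] /ffunP E; congr (_, _).
    by have := E ord0; rewrite !ffunE !fcons0.
  by apply/ffunP => i; have := E (lift ord0 i); rewrite !ffunE !fconsS.
- move=> s /(_ (s ord0, [ffun i => s (lift ord0 i)])) /eqP[].
  apply/ffunP => i; rewrite ffunE; congr (_ i).
  by apply: fconsP => [//|j]; rewrite ffunE.
- apply: eq_rsum H => -[k s] /=; congr F; apply: fconsP => [|i].
    by rewrite ffunE fcons0.
  by rewrite ffunE fconsS.
Qed.

Lemma multi_expand_dual B C (K : choiceType) n (h : ('I_n -> B) -> C) (l : C -> R)
    (y : 'I_n -> K -> B) (x : 'I_n -> B) : multi h -> in_dual l ->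
  (forall i, csum (y i) (x i)) ->
  rsum (fun s : {ffun 'I_n -> K} => l (h (fun i => y i (s i)))) (l (h x)).
Proof.
move=> mh dl yx; apply: (multi_expand (F := l \o h)) => //.
  by move=> v; exact: dual_ge0.
by move=> i v; exact: (linmap_dual (m_slice mh i v) dl).
Qed.

End Coefs.

(** * Polarization *)

Section Polarization.
Context {R : realType} {Ar : arities}.
Implicit Types A B C D : integrableConeType R Ar.

Definition psign n (e : {ffun 'I_n -> bool}) : R := \prod_i (-1) ^+ (~~ e i).

Lemma psign_norm n (e : {ffun 'I_n -> bool}) : `|psign e| = 1.
Proof.
rewrite normr_prod big1// => i _.
by rewrite normrX normrN1 expr1n.
Qed.

(** Inclusion-exclusion. The sum factors over [i]: an index missed by [s] contributes [1 - 1], an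
    index hit by [s] forces [e i] and contributes 1. *)
Lemma signed_count n N (s : {ffun 'I_N -> 'I_n}) :
  \sum_(e : {ffun 'I_n -> bool}) psign e * ([forall j, e (s j)])%:R =
  ([forall i, i \in codom s])%:R :> R.
Proof.
pose G i (b : bool) : R := (-1) ^+ (~~ b) * (if i \in codom s then b%:R else 1).
transitivity (\sum_(e : {ffun 'I_n -> bool}) \prod_i G i (e i)).
  apply: eq_bigr => e _; rewrite big_split /=; congr (_ * _).
  case: forallP => [h|/existsNP[j /negP/negPf ej]].
    rewrite big1// => i _; case: ifP => // /codomP[j ->].
    by rewrite h.
  by rewrite (bigD1 (s j))//= codom_f ej mul0r.
rewrite -bigA_distr_bigA /=.
case: forallP => [h|/existsNP[i /negP/negPf ni]].
  by rewrite big1// => i _; rewrite big_bool /G h /= !mulr1 mulr0 addr0.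
by rewrite (bigD1 i)//= big_bool /G ni /= !mulr1 expr0 expr1 subrr mul0r.
Qed.

Lemma pol_term B C n N (h : ('I_N -> B) -> C) (l : C -> R) (v : 'I_n -> B)
    (e : {ffun 'I_n -> bool}) (s : {ffun 'I_N -> 'I_n}) : multi h -> in_dual l ->
  l (h (fun j => v (s j) *+ e (s j))) = ([forall j, e (s j)])%:R * l (h (v \o s)).
Proof.
move=> mh dl; case: forallP => [es|/existsNP[j /negP/negPf ej]].
  by rewrite mul1r; congr (l (h _)); apply/funext => j /=; rewrite es.
rewrite mul0r -(dual0 dl); congr l.
set w := (fun j => _); rewrite -(dfwith_id w j) {2}/w ej.
exact: (linmap0 (m_slice mh j w)).
Qed.

(** Each diagonal value at a subset sum is expanded over choice functions [s]; after exchanging the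
    sums, [signed_count] keeps only the surjective ones. *)
Lemma pol_expand B C n N (h : ('I_N -> B) -> C) (l : C -> R) (v : 'I_n -> B) :
  multi h -> in_dual l ->
  \sum_(e : {ffun 'I_n -> bool}) psign e * l (h (fun=> \sum_i v i *+ e i)) =
  \sum_(s : {ffun 'I_N -> 'I_n}) ([forall i, i \in codom s])%:R * l (h (v \o s)).
Proof.
move=> mh dl.
transitivity (\sum_(e : {ffun 'I_n -> bool}) \sum_(s : {ffun 'I_N -> 'I_n})
    psign e * ([forall j, e (s j)])%:R * l (h (v \o s))).
  apply: eq_bigr => e _.
  have := multi_expand_dual (y := fun _ i => v i *+ e i) mh dl (fun=> csum_fin _).
  move=> /(rsum_uniq (rsum_fin (fun=> dual_ge0 dl _))) <-.
  by rewrite mulr_sumr; apply: eq_bigr => s _ /=; rewrite (pol_term v e s mh dl) mulrA.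
rewrite exchange_big /=; apply: eq_bigr => s _.
by rewrite -mulr_suml signed_count.
Qed.

(** No map from ['I_N] onto the larger ['I_n] exists. *)
Lemma pol_lt B C n N (h : ('I_N -> B) -> C) (l : C -> R) (v : 'I_n -> B) :
  multi h -> in_dual l -> (N < n)%N ->
  \sum_(e : {ffun 'I_n -> bool}) psign e * l (h (fun=> \sum_i v i *+ e i)) = 0.
Proof.
move=> mh dl Nn; rewrite (pol_expand v mh dl) big1// => s _.
case: forallP => [hs|]; rewrite ?mul0r//.
have : (#|codom s| <= N)%N by rewrite (leq_trans (leq_image_card _ _))// cardT size_enum_ord.
have /subset_leq_card : 'I_n \subset codom s by apply/fintype.subsetP => i _; exact: hs.
by rewrite card_ord => /leq_trans h1 /h1; rewrite leqNgt Nn.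
Qed.

(* This is n!, but only its positivity matters. *)
Definition onto_count n : R :=
  \sum_(s : {ffun 'I_n -> 'I_n}) ([forall i, i \in codom s])%:R.

Lemma onto_count_gt0 n : 0 < onto_count n.
Proof.
rewrite /onto_count (bigD1 [ffun i => i])//= ltr_wpDr ?sumr_ge0//.
case: forallP => // /existsNP[i []]; apply/codomP; exists i.
by rewrite ffunE.
Qed.

(** A map from ['I_n] onto itself is a permutation, which the symmetry of [h] absorbs. *)
Lemma pol_eq B C n (h : ('I_n -> B) -> C) (l : C -> R) (v : 'I_n -> B) :
  in_Sym h -> in_dual l ->
  \sum_(e : {ffun 'I_n -> bool}) psign e * l (h (fun=> \sum_i v i *+ e i)) =
  onto_count n * l (h v).
Proof.
move=> /in_SymP[mh hsym] dl; rewrite (pol_expand v mh dl) mulr_suml; apply: eq_bigr => s _.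
case: forallP => [hs|]; rewrite ?mul0r// !mul1r.
have inj_s : injective s.
  apply/injectiveP; rewrite /injectiveb/dinjectiveb -/(codom s).
  apply: (@leq_size_uniq _ (enum 'I_n)); first exact: enum_uniq.
    by move=> i _; exact: hs.
  by rewrite size_codom -cardE.
rewrite -(hsym (perm inj_s) v); congr (l (h _)).
by apply/funext => i /=; rewrite permE.
Qed.

(** The value 0 outside the ball is a default; it allows [pol_diff] to be written for every [t],
    while the limits below take it only at points inside. *)
Definition ext_ball B C (f : uball B -> C) (x : B) : C :=
  if pselect (cnorm x <= 1) is left x1 then f (exist _ x x1) else 0.

Lemma ext_ballE B C (f : uball B -> C) (x : uball B) : ext_ball f (\val x) = f x.
Proof.
rewrite /ext_ball; case: pselect => [x1|]; last by case: x.
by congr f; exact: val_inj.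
Qed.

Lemma ext_ballT B C (f : uball B -> C) (x : B) (x1 : cnorm x <= 1) :
  ext_ball f x = f (exist _ x x1).
Proof. by rewrite -ext_ballE. Qed.

Definition pol_diff B C n (f : uball B -> C) (l : C -> R) (v : 'I_n -> B) (t : R) : R :=
  \sum_(e : {ffun 'I_n -> bool})
    psign e * l (ext_ball f (nnr t *: \sum_i v i *+ e i)).

Lemma cvg_rsum (I : Type) (r : seq I) (u : I -> nat -> R) (a : I -> R) :
  (forall i, u i @ \oo --> a i) ->
  (fun N => \sum_(i <- r) u i N) @ \oo --> \sum_(i <- r) a i.
Proof.
move=> ua; elim: r => [|i r IH].
  by under eq_fun do rewrite big_nil; rewrite big_nil; exact: cvg_cst.
under eq_fun do rewrite big_cons; rewrite big_cons.
exact: cvgD (ua i) IH.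
Qed.

(** Taylor remainder: for [k > n] and [t] in the unit interval, [t ^+ k] is at most [t ^+ n.+1]. The
    estimate holds for all long partial sums and passes to the limit [D]. *)
Lemma power_extract (n : nat) (q b : nat -> R) (D M t : R) : 0 <= t <= 1 ->
  (forall k, `|q k| <= b k) -> (forall N, \sum_(k < N) b k <= M) ->
  (forall k, (k < n)%N -> q k = 0) ->
  (fun N => \sum_(k < N) t ^+ k * q k) @ \oo --> D ->
  `|D - t ^+ n * q n| <= t ^+ n.+1 * M.
Proof.
move=> /andP[t0 t1] qb bM q0 cD.
have b0 k : 0 <= b k := le_trans (normr_ge0 _) (qb k).
have H : (fun N => `|\sum_(k < N) t ^+ k * q k - t ^+ n * q n|) @ \oo -->
    `|D - t ^+ n * q n|.
  by apply: cvg_norm; apply: cvgB => //; exact: cvg_cst.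
rewrite -(cvg_lim _ H)//; apply: limr_le; first exact: cvgP H.
(* Only from [n + 1] terms on does the partial sum contain the term of degree [n]. *)
exists n.+1 => // N /= nN.
have nN' : (n < N)%N by [].
rewrite (bigD1 (Ordinal nN'))//= addrAC subrr add0r.
apply: le_trans (ler_norm_sum _ _ _) _.
apply: (@le_trans _ _ (\sum_(k < N) t ^+ n.+1 * b k)); last first.
  by rewrite -mulr_sumr ler_wpM2l// exprn_ge0.
rewrite big_mkcond; apply: ler_sum => k _; case: ifPn => [kn|_]; last first.
  by rewrite mulr_ge0// exprn_ge0.
have := kn; rewrite -val_eqE /= neq_ltn => /orP[kn'|kn'].
  by rewrite q0// mulr0 normr0 mulr_ge0// exprn_ge0.
rewrite normrM (ger0_norm (exprn_ge0 _ t0)) ler_pM ?exprn_ge0//.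
exact: ler_wiXn2l.
Qed.

Lemma cle_subsum B n (v : 'I_n -> B) (e : {ffun 'I_n -> bool}) :
  cle (\sum_i v i *+ e i) (\sum_i v i).
Proof.
exists (\sum_i v i *+ ~~ e i); rewrite -big_split/=; apply: eq_bigr => i _.
by case: (e i); rewrite ?addr0// add0r.
Qed.

(** The scale [c] brings every subset sum into the ball, and [t] runs through the inverses of the
    positive integers. The remainder of [power_extract] is [O(t ^+ n.+1)], so that it still tends to
    0 after division by [t ^+ n]. *)
Lemma coef_lim B C (f : uball B -> C) h n (l : C -> R) (v : 'I_n -> B) (c : R) :
  has_coefs f h -> in_dual l -> 0 < c -> cnorm (nnr c *: \sum_i v i) <= 1 ->
  (fun j : nat => j.+1%:R ^+ n * pol_diff f l v (j.+1%:R^-1 * c)) @ \oo -->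
  c ^+ n * (onto_count n * l (h n v)).
Proof.
move=> fh dl c0 x1; have [hs hf] := fh.
have mh k := has_coefs_multi k fh.
pose x0 : uball B := exist (fun x => is_true (cnorm x <= 1)) _ x1.
pose w (e : {ffun 'I_n -> bool}) := \sum_i v i *+ e i.
pose q k := c ^+ k * \sum_(e : {ffun 'I_n -> bool}) psign e * l (h k (fun=> w e)).
(* Every subset sum lies below the full one, so the expansion at [x0] is a majorant for all [e] at
   once; its total is [l (f x0)], counted once for each [e]. *)
pose M : R := \sum_(e : {ffun 'I_n -> bool}) l (f x0).
have wle e : cle (w e) (\sum_i v i) by exact: cle_subsum.
have hZ k (a : R) x : 0 <= a -> l (h k (fun=> nnr a *: x)) = a ^+ k * l (h k (fun=> x)).
  move=> a0; rewrite (multi_homog _ _ (mh k)) dualZ// rmorphXn/= val_nnr//.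
  by rewrite card_ord.
have lx0 : rsum (fun k => l (h k (fun=> \val x0))) (l (f x0)) := hf x0 l dl.
have main t : 0 <= t <= 1 -> `|pol_diff f l v (t * c) - t ^+ n * q n| <= t ^+ n.+1 * M.
  move=> /andP[t0 t1].
  apply: (@power_extract n q (fun k => \sum_(e : {ffun 'I_n -> bool})
      l (h k (fun=> \val x0)))); first by rewrite t0.
  - move=> k; rewrite /q mulr_sumr; apply: le_trans (ler_norm_sum _ _ _) _.
    apply: ler_sum => e _; rewrite mulrCA normrM psign_norm mul1r.
    rewrite -hZ; last exact: ltW.
    rewrite ger0_norm; last exact: dual_ge0.
    apply: (dual_le dl); apply: multi_le => // _; exact: cle_scale.
  - move=> N; rewrite exchange_big/=; apply: ler_sum => e _.
    by apply: rsum_part lx0 => k; exact: dual_ge0.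
  - by move=> k kn; rewrite /q /w (pol_lt v (mh k) dl kn) mulr0.
  - rewrite (_ : (fun N => _) = fun N => \sum_(e : {ffun 'I_n -> bool})
       psign e * \sum_(k < N) l (h k (fun=> nnr (t * c) *: w e))); last first.
      apply/funext => N; under [RHS]eq_bigr do rewrite mulr_sumr.
      rewrite exchange_big/=; apply: eq_bigr => k _.
      rewrite /q mulrA mulr_sumr; apply: eq_bigr => e _.
      by rewrite hZ; [rewrite exprMn mulrCA|exact: mulr_ge0 (ltW _)].
    apply: cvg_rsum => e; apply: cvgM; first exact: cvg_cst.
    have we1 : cnorm (nnr (t * c) *: w e) <= 1.
      rewrite (nnrM t0 (ltW c0)) -scalerA cnorm_nnr//.
      apply: mulr_ile1 => //; first exact: cnorm_ge0.
      by apply: (le_trans _ x1); apply: cle_norm; exact: cle_scale.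
    rewrite (ext_ballT _ we1).
    have /rsum_natP := hf (exist (fun x => is_true (cnorm x <= 1)) _ we1) l dl; apply=> k; exact: dual_ge0.
rewrite -(pol_eq v (hs n) dl) -[X in _ --> X]/(q n).
apply/cvgrPdist_le => e e0.
have /cvgrPdist_le/(_ _ e0) : (fun j : nat => M * j.+1%:R^-1) @ \oo --> M * 0.
  by apply: cvgM; [exact: cvg_cst|exact: cvg_harmonic].
apply: filterS => j; rewrite mulr0 sub0r normrN => Me.
have j0 : (0 : R) < j.+1%:R by [].
have jb : 0 <= (j.+1%:R^-1 : R) <= 1 by rewrite invr_ge0 ltW//= invf_le1// ler1n.
have := main _ jb; rewrite distrC => H.
apply: le_trans Me; rewrite -(ler_pM2l (x := j.+1%:R^-1 ^+ n)) ?exprn_gt0 ?invr_gt0//.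
have -> : j.+1%:R^-1 ^+ n * `|q n - j.+1%:R ^+ n * pol_diff f l v (j.+1%:R^-1 * c)| =
   `|j.+1%:R^-1 ^+ n * q n - pol_diff f l v (j.+1%:R^-1 * c)|.
  rewrite -{1}(ger0_norm (x := j.+1%:R^-1 ^+ n)) ?exprn_ge0 ?invr_ge0 ?ltW//.
  rewrite -normrM mulrBr [X in `|_ - X|]mulrA -exprMn mulVf ?gt_eqF//.
  by rewrite expr1n mul1r.
apply: le_trans H _; rewrite exprSr -mulrA ler_wpM2l//.
by rewrite mulrC ler_norm.
Qed.

(** [pol_diff] depends on [f] alone, so both families have the same limit, and the factors in front
    of [l (h n v)] are nonzero. *)
Lemma has_coefs_uniq B C (f : uball B -> C) h h' n :
  has_coefs f h -> has_coefs f h' -> h n = h' n.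
Proof.
move=> fh fh'; apply/funext => v; apply: (mtest_sep (Ar := Ar)) => m mm.
have dm := mtest_in_dual mm.
have d0 : 0 < cnorm (\sum_i v i) + 1 by rewrite ltr_wpDl// cnorm_ge0.
have c0 : 0 < (cnorm (\sum_i v i) + 1)^-1 by rewrite invr_gt0.
have c1 : cnorm (nnr (cnorm (\sum_i v i) + 1)^-1 *: \sum_i v i) <= 1.
  by rewrite cnorm_nnr ?(ltW c0)// ler_pdivrMl// mulr1 lerDl.
have E := cvg_unique (@Rhausdorff R) (coef_lim fh dm c0 c1) (coef_lim fh' dm c0 c1).
have cn0 := lt0r_neq0 (exprn_gt0 n c0).
apply: (mulfI (lt0r_neq0 (onto_count_gt0 n))); apply: (mulfI cn0).
exact: E.
Qed.

End Polarization.

(** * The category of integrable cones and analytic functions *)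

Section ACones.
Context {R : realType} {Ar : arities}.
Implicit Types A B C D : integrableConeType R Ar.

Lemma analytic_measurable B C (f : uball B -> C) : analytic f -> measurable_map f.
Proof.
move=> /analyticP[[M fM] [h fh]] X b pb.
apply: (@path_csum _ _ _ _ (fun k r => h k (fun=> \val (b r)))).
- by move=> k; apply: (m_path (has_coefs_multi k fh) (beta := fun _ r => \val (b r))).
- by move=> r; exact: fh.2.
- by exists M => r; exact: fM.
Qed.

Lemma analytic_multi B C (I : finType) (h : (I -> B) -> C) M : multi h ->
  (forall x : uball B, cnorm (h (fun=> \val x)) <= M) ->
  analytic (fun x : uball B => h (fun=> \val x)).
Proof.
move=> mh hM; apply: (@analytic_sum _ _ _ _ _ M unit (fun=> I) (fun=> h)) => // x l dl.
apply: (@rsum_single _ unit (fun=> l (h (fun=> \val x))) tt); first exact: dual_ge0.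
by case.
Qed.

Lemma analytic_linmap B C (f : B -> C) : linmap f ->
  (exists M, forall x : uball B, cnorm (f (\val x)) <= M) ->
  analytic (fun x : uball B => f (\val x)).
Proof. by move=> lf [M fM]; exact: (analytic_multi (multi_lin lf) fM). Qed.

(** In the part of [g] of degree [n], each of the [n] arguments is replaced by the expansion of [f]:
    a term is given by [n] and by one degree per argument. *)
Lemma analytic_comp A B C (f : uball A -> uball B) (g : uball B -> C) :
  analytic (fun x => \val (f x)) -> analytic g -> analytic (g \o f).
Proof.
move=> /analyticP[_ [hf ff]] /analyticP[[M gM] [hg gg]].
apply: (@analytic_sum _ _ _ _ _ M {n : nat & {ffun 'I_n -> nat}}
  (fun j => {i : 'I_(tag j) & 'I_(tagged j i)} : finType)
  (fun j v => hg (tag j) (fun i => hf (tagged j i) (fun k => v (Tagged _ k))))).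
- by move=> x; exact: gM.
- move=> [n k] /=.
  apply: (multi_comp (g := hg n) (f := fun i => hf (k i))).
    exact: (has_coefs_multi n gg).
  by move=> i; exact: (has_coefs_multi _ ff).
- move=> x l dl.
  apply/(rsum_tag (T := fun n => {ffun 'I_n -> nat})
    (a := fun n k => l (hg n (fun i => hf (k i) (fun=> \val x))))
    (s := fun n => l (hg n (fun=> \val (f x))))).
  + by move=> *; exact: dual_ge0.
  + move=> n; apply: (@multi_expand_dual _ _ _ _ nat n (hg n) l
      (fun _ k => hf k (fun=> \val x)) (fun=> \val (f x))) => //.
      exact: (has_coefs_multi n gg).
    by move=> i; exact: ff.2.
  + exact: (gg.2 (f x) l dl).
Qed.

Lemma acones_hom_eq B C (f g : acones_hom B C) : ah_fun f = ah_fun g -> f = g.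
Proof.
case: f g => [f a1 b1 c1] [g a2 b2 c2] /= fg.
case: _ / fg in a2 b2 c2 *.
by congr AconesHom; exact: Prop_irrelevance.
Qed.

Lemma acones_hom_ext B C (f g : acones_hom B C) : (forall x, f x = g x) -> f = g.
Proof. by move=> fg; apply/acones_hom_eq/funext. Qed.

Definition mk_hom B C (f : uball B -> C) (af : analytic f) (nf : forall x, cnorm (f x) <= 1) :
  acones_hom B C := AconesHom af (analytic_measurable af) nf.

Lemma ah_ball_analytic B C (f : acones_hom B C) : analytic (fun x => \val (ah_ball f x)).
Proof. exact: (ah_analytic f). Qed.

Lemma hom_linmap_subproof B C (f : B -> C) : linmap f ->
  (forall x, cnorm (f x) <= cnorm x) -> analytic (fun x : uball B => f (\val x)).
Proof.
move=> lf fn; apply: analytic_linmap => //; exists 1 => x.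
by rewrite (le_trans (fn _))//; exact: (proj2_sig x).
Qed.

Definition hom_linmap B C (f : B -> C) (lf : linmap f)
    (fn : forall x, cnorm (f x) <= cnorm x) : acones_hom B C :=
  mk_hom (hom_linmap_subproof lf fn) (fun x => le_trans (fn _) (proj2_sig x)).

Definition hom_id B : acones_hom B B := hom_linmap (linmap_id B) (fun=> lexx _).

Definition hom_comp A B C (g : acones_hom B C) (f : acones_hom A B) : acones_hom A C :=
  mk_hom (analytic_comp (ah_ball_analytic f) (ah_analytic g))
    (fun x => ah_norm g (ah_ball f x)).

(** Kept transparent: later steps identify composites with their values by conversion. *)
Definition acones : category (@acones_hom R Ar).
Proof.
apply: (@Category _ _ hom_id hom_comp) => [B C f|B C f|A B C D h g f].
- exact: acones_hom_ext.
- apply: acones_hom_ext => x /=; congr (f _); exact: val_inj.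
- apply: acones_hom_ext => x /=; congr (h _); exact: val_inj.
Defined.

End ACones.
Arguments acones : clear implicits.

(** * The terminal cone *)

(* The parameters only key the instances below. *)
Definition one_cone (R : realType) (Ar : arities) : Type := unit.

Section OneCone.
Context {R : realType} {Ar : arities}.
Local Notation one := (one_cone R Ar).

HB.instance Definition _ := Choice.copy one unit.

Lemma one_eq (x y : one) : x = y. Proof. by case: x; case: y. Qed.

HB.instance Definition _ := @GRing.isNmodule.Build one tt (fun x _ => x)
  (fun _ _ _ => one_eq _ _) (fun _ _ => one_eq _ _) (fun _ => one_eq _ _).

Definition one_scale (a : Rnn R) (x : one) : one := x.
HB.instance Definition _ := @GRing.Nmodule_isLSemiModule.Build (Rnn R) one one_scale
  (fun _ _ _ => one_eq _ _) (fun _ => one_eq _ _) (fun _ => one_eq _ _)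
  (fun _ _ _ => one_eq _ _) (fun _ _ _ => one_eq _ _).

HB.instance Definition _ := @isPrecone.Build R one
  (fun _ _ _ _ => one_eq _ _) (fun _ _ _ => one_eq _ _).

Lemma one_norm0 (l : Rnn R) (x : one) : (0 : R) = \val l * 0. Proof. by rewrite mulr0. Qed.
Lemma one_normD (x y : one) : (0 : R) <= 0 + 0. Proof. by rewrite addr0. Qed.
Lemma one_complete (u : nat -> one) : cincreasing u -> (forall n : nat, (0 : R) <= 1) ->
  exists2 x : one, is_lub (@cle R one) u x & (0 : R) <= 1.
Proof. by move=> _ _; exists 0 => //; split=> [n|y _]; exists 0; exact: one_eq. Qed.

HB.instance Definition _ := @isCone.Build R one (fun=> 0)
  (fun=> lexx _) one_norm0 (fun _ _ => one_eq _ _) one_normD (fun _ _ => lexx _)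
  one_complete.

(** No tests are needed to separate a single point, and the norm 0 is [sup set0]. *)
Definition one_test (X : ar_ob Ar) : set (X -> one -> R) := set0.

Lemma one_test_norm (x : one) : cnorm x =
  sup [set m ar_pt x / dual_norm (m ar_pt) | m in
     [set m | @one_test (ar_one Ar) m /\ m ar_pt <> (fun _ : one => 0)]].
Proof.
exact: (@cnorm_testE R one _ ar_pt (@one_test (ar_one Ar)) x).
Qed.

Lemma one_test_dual (X : ar_ob Ar) (m : X -> one -> R) : one_test m ->
  forall r, in_dual (m r).
Proof. by []. Qed.
Lemma one_test_meas (X : ar_ob Ar) (m : X -> one -> R) : one_test m ->
  forall x : one, cnorm x <= 1 ->
    measurable_fun [set: X] (fun r : X => m r x) /\ (forall r : X, 0 <= m r x <= 1).
Proof. by []. Qed.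
Lemma one_test_comp (X Y : ar_ob Ar) (phi : Y -> X) (m : X -> one -> R) :
  measurable_fun [set: Y] phi -> one_test m -> one_test (fun s x => m (phi s) x).
Proof. by []. Qed.
Lemma one_test_sep (x1 x2 : one) :
  (forall m, @one_test (ar_one Ar) m -> m ar_pt x1 = m ar_pt x2) -> x1 = x2.
Proof. by move=> _; exact: one_eq. Qed.

HB.instance Definition _ := @isMeasurableCone.Build R Ar one one_test
  one_test_dual one_test_meas one_test_comp one_test_sep one_test_norm.

Lemma one_integral (X : ar_ob Ar) (gamma : X -> one) : is_path gamma ->
  forall mu : {finite_measure set X -> \bar R}, exists x : one, is_integral gamma mu x.
Proof. by move=> _ mu; exists 0. Qed.

HB.instance Definition _ := @isIntegrableCone.Build R Ar one one_integral.

Lemma one_terminal : is_terminal (@acones_hom R Ar) (one : integrableConeType R Ar).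
Proof.
move=> A; have n0 (x : uball A) : cnorm (0 : one) <= 1 by rewrite cnorm0.
have a0 : analytic (fun x : uball A => 0 : one).
  exact: (analytic_linmap (linmap_zero _ _) (ex_intro _ 1 n0)).
exists (mk_hom a0 n0); split=> // f' _.
by apply: acones_hom_ext => x; exact: one_eq.
Qed.

End OneCone.

(** * Products *)

Section ProdCone.
Context {R : realType}.

Section Precone.
Variables (A B : preconeType R).

Lemma prod_addIr (x x1 x2 : A * B) : x1 + x = x2 + x -> x1 = x2.
Proof.
case: x x1 x2 => [a b] [a1 b1] [a2 b2] [] /precone_addIr -> /precone_addIr ->.
by [].
Qed.

Lemma prod_add_eq0 (x1 x2 : A * B) : x1 + x2 = 0 -> x1 = 0.
Proof.
by case: x1 x2 => [a1 b1] [a2 b2] [] /precone_add_eq0 -> /precone_add_eq0 ->.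
Qed.

HB.instance Definition _ := isPrecone.Build R (A * B)%type prod_addIr prod_add_eq0.
End Precone.

Lemma cle_pair (A B : preconeType R) (x y : A * B) :
  cle x y <-> cle x.1 y.1 /\ cle x.2 y.2.
Proof.
case: x y => [a b] [a' b']; split=> [[[z w]]|[[z] /= -> [w] /= ->]].
  by case=> -> ->; split; [exists z|exists w].
by exists (z, w).
Qed.

Section Cone.
Variables (A B : coneType R).

(** With the maximum, the unit ball of the product is the product of the unit balls, so two
    morphisms can be paired. *)
Definition prod_norm (x : A * B) : R := Num.max (cnorm x.1) (cnorm x.2).

Lemma prod_norm_ge0 x : 0 <= prod_norm x.
Proof. by rewrite /prod_norm le_max cnorm_ge0. Qed.

Lemma prod_normZ (l : Rnn R) x : prod_norm (l *: x) = \val l * prod_norm x.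
Proof. by rewrite /prod_norm maxr_pMr ?val_Rnn_ge0//= !cnormZ. Qed.

Lemma prod_norm0 x : prod_norm x = 0 -> x = 0.
Proof.
case: x => [a b] n0; congr (_, _); apply/cnorm0_eq0/le_anti; rewrite cnorm_ge0 -n0.
  by rewrite /prod_norm le_max lexx.
by rewrite /prod_norm le_max lexx orbT.
Qed.

Lemma prod_normD x y : prod_norm (x + y) <= prod_norm x + prod_norm y.
Proof.
rewrite ge_max; apply/andP; split.
  by rewrite (le_trans (ler_cnormD _ _))// lerD// le_max lexx.
by rewrite (le_trans (ler_cnormD _ _))// lerD// le_max lexx orbT.
Qed.

Lemma prod_normDr x y : prod_norm x <= prod_norm (x + y).
Proof.
rewrite ge_max; apply/andP; split.
  by rewrite le_max ler_cnormDr.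
by rewrite le_max ler_cnormDr orbT.
Qed.

Lemma prod_lub (u : nat -> A * B) x :
  is_lub (@cle R A) (fst \o u) x.1 -> is_lub (@cle R B) (snd \o u) x.2 ->
  is_lub (@cle R (A * B)%type) u x.
Proof.
move=> [ux xl] [vx vl]; split=> [n|y uy]; apply/cle_pair; split.
- exact: ux.
- exact: vx.
- by apply: xl => n; case/cle_pair: (uy n).
- by apply: vl => n; case/cle_pair: (uy n).
Qed.

Lemma prod_complete (u : nat -> A * B) : cincreasing u ->
  (forall n, prod_norm (u n) <= 1) ->
  exists2 x : A * B, is_lub (@cle R (A * B)%type) u x & prod_norm x <= 1.
Proof.
move=> iu nu.
have n1 n : cnorm (u n).1 <= 1 by rewrite (le_trans _ (nu n))// le_max lexx.
have n2 n : cnorm (u n).2 <= 1 by rewrite (le_trans _ (nu n))// le_max lexx orbT.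
have [a ua a1] := @cone_complete R A (fst \o u)
  (fun n => (proj1 (cle_pair _ _) (iu n)).1) n1.
have [b ub b1] := @cone_complete R B (snd \o u)
  (fun n => (proj1 (cle_pair _ _) (iu n)).2) n2.
by exists (a, b); [exact: prod_lub|rewrite /prod_norm ge_max a1].
Qed.

HB.instance Definition _ := isCone.Build R (A * B)%type
  prod_norm_ge0 prod_normZ prod_norm0 prod_normD prod_normDr prod_complete.

Lemma cnorm_fst (x : A * B) : cnorm x.1 <= cnorm x.
Proof. by rewrite le_max lexx. Qed.

Lemma cnorm_snd (x : A * B) : cnorm x.2 <= cnorm x.
Proof. by rewrite le_max lexx orbT. Qed.

Lemma cnorm_pair (a : A) (b : B) M : cnorm a <= M -> cnorm b <= M -> cnorm (a, b) <= M.
Proof. by move=> aM bM; rewrite ge_max aM. Qed.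

Lemma fst_omega : omega_continuous (@cle R A) (fst : A * B -> A).
Proof.
split=> [x y /cle_pair[]//|u x iu _ [ux xl]]; split=> [n|y uy].
  by case/cle_pair: (ux n).
(* Changing only the first component of the lub still gives an upper bound of the sequence of
   pairs. *)
have /cle_pair[] // : cle x (y, x.2).
by apply: xl => n; apply/cle_pair; split=> //=; [exact: uy|case/cle_pair: (ux n)].
Qed.

Lemma snd_omega : omega_continuous (@cle R B) (snd : A * B -> B).
Proof.
split=> [x y /cle_pair[]//|u x iu _ [ux xl]]; split=> [n|y uy].
  by case/cle_pair: (ux n).
have /cle_pair[] // : cle x (x.1, y).
by apply: xl => n; apply/cle_pair; split=> //=; [case/cle_pair: (ux n)|exact: uy].
Qed.

Lemma fst_dual (l : A -> R) : in_dual l -> in_dual (fun x : A * B => l x.1).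
Proof. by move=> dl; apply: (omega_dual (f := fst)) => //; exact: fst_omega. Qed.

Lemma snd_dual (l : B -> R) : in_dual l -> in_dual (fun x : A * B => l x.2).
Proof. by move=> dl; apply: (omega_dual (f := snd)) => //; exact: snd_omega. Qed.

Lemma dual_norm_fst (l : A -> R) : dual_norm (fun x : A * B => l x.1) = dual_norm l.
Proof.
congr sup; apply/seteqP; split=> [_ [x x1 <-]|_ [a a1 <-]] /=.
  by exists x.1 => //=; exact: le_trans (cnorm_fst _) x1.
by exists (a, 0) => //=; apply: cnorm_pair; rewrite ?cnorm0.
Qed.

Lemma dual_norm_snd (l : B -> R) : dual_norm (fun x : A * B => l x.2) = dual_norm l.
Proof.
congr sup; apply/seteqP; split=> [_ [x x1 <-]|_ [a a1 <-]] /=.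
  by exists x.2 => //=; exact: le_trans (cnorm_snd _) x1.
by exists (0, a) => //=; apply: cnorm_pair; rewrite ?cnorm0.
Qed.

End Cone.

Section Measurable.
Context {Ar : arities}.
Variables (A B : measurableConeType R Ar).

Definition prod_test (X : ar_ob Ar) : set (X -> A * B -> R) :=
  [set m | (exists2 m1, mtest X m1 & m = fun r x => m1 r x.1) \/
           (exists2 m2, mtest X m2 & m = fun r x => m2 r x.2)].

Lemma prod_test_dual (X : ar_ob Ar) (m : X -> A * B -> R) : prod_test m ->
  forall r, in_dual (m r).
Proof.
by move=> [[m1 mm ->]|[m1 mm ->]] r; [apply: fst_dual|apply: snd_dual]; exact: mtest_dual.
Qed.

Lemma prod_test_meas (X : ar_ob Ar) (m : X -> A * B -> R) : prod_test m ->
  forall x : A * B, cnorm x <= 1 ->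
    measurable_fun [set: X] (fun r : X => m r x) /\ (forall r : X, 0 <= m r x <= 1).
Proof.
move=> [[m1 mm ->]|[m1 mm ->]] x x1; apply: mtest_meas => //.
  exact: le_trans (cnorm_fst _) x1.
exact: le_trans (cnorm_snd _) x1.
Qed.

Lemma prod_test_comp (X Y : ar_ob Ar) (phi : Y -> X) (m : X -> A * B -> R) :
  measurable_fun [set: Y] phi -> prod_test m -> prod_test (fun s x => m (phi s) x).
Proof.
move=> mphi [[m1 mm ->]|[m1 mm ->]]; [left|right].
  by exists (fun s x => m1 (phi s) x) => //; exact: mtest_comp.
by exists (fun s x => m1 (phi s) x) => //; exact: mtest_comp.
Qed.

Lemma prod_test_sep (x1 x2 : A * B) :
  (forall m, @prod_test (ar_one Ar) m -> m ar_pt x1 = m ar_pt x2) -> x1 = x2.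
Proof.
case: x1 x2 => [a1 b1] [a2 b2] h; congr (_, _); apply: (mtest_sep (Ar := Ar)) => m mm.
  by apply: (h (fun r x => m r x.1)); left; exists m.
by apply: (h (fun r x => m r x.2)); right; exists m.
Qed.

Lemma prod_test_norm (x : A * B) : cnorm x =
  sup [set m ar_pt x / dual_norm (m ar_pt) | m in
     [set m | @prod_test (ar_one Ar) m /\ m ar_pt <> (fun _ : A * B => 0)]].
Proof.
apply: (@cnorm_testE R (A * B)%type _ ar_pt (@prod_test (ar_one Ar)) x).
- by move=> m pm; exact: prod_test_dual.
- by move=> m /prod_test_meas h y /h[_ /(_ ar_pt)/andP[]].
- move=> M M0 h; case: x h => [a b] h; apply: cnorm_pair; apply: cnorm_le => // m mm.
    by rewrite -(@dual_norm_fst A B); apply: (h (fun r x => m r x.1)); left; exists m.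
  by rewrite -(@dual_norm_snd A B); apply: (h (fun r x => m r x.2)); right; exists m.
Qed.

HB.instance Definition _ := isMeasurableCone.Build R Ar (A * B)%type
  prod_test_dual prod_test_meas prod_test_comp prod_test_sep prod_test_norm.

Lemma path_pair (X : ar_ob Ar) (g : X -> A * B) :
  is_path g <-> is_path (fun r => (g r).1) /\ is_path (fun r => (g r).2).
Proof.
split=> [[[M gM] mg]|[[[M gM] mg] [[N hN] mh]]].
  split; split=> [|Y m mm].
  - by exists M => r; exact: le_trans (cnorm_fst _) (gM r).
  - by apply: (mg Y (fun r x => m r x.1)); left; exists m.
  - by exists M => r; exact: le_trans (cnorm_snd _) (gM r).
  - by apply: (mg Y (fun r x => m r x.2)); right; exists m.
split=> [|Y _ [[m mm ->]|[m mm ->]]]; last 2 first.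
- exact: (mg Y m mm).
- exact: (mh Y m mm).
exists (Num.max M N) => r; rewrite (surjective_pairing (g r)).
by apply: cnorm_pair; rewrite le_max ?gM ?hN ?orbT.
Qed.

Lemma integral_pair (X : ar_ob Ar) (g : X -> A * B)
    (mu : {finite_measure set X -> \bar R}) (x : A * B) :
  is_integral g mu x <-> is_integral (fun r => (g r).1) mu x.1 /\
                         is_integral (fun r => (g r).2) mu x.2.
Proof.
split=> [h|[h1 h2] _ [[m mm ->]|[m mm ->]]]; last 2 first.
- exact: h1.
- exact: h2.
split=> m mm.
  by apply: (h (fun r x => m r x.1)); left; exists m.
by apply: (h (fun r x => m r x.2)); right; exists m.
Qed.

End Measurable.

Section Integrable.
Context {Ar : arities}.
Variables (A B : integrableConeType R Ar).

Lemma prod_integral (X : ar_ob Ar) (g : X -> A * B) : is_path g ->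
  forall mu : {finite_measure set X -> \bar R}, exists x : A * B, is_integral g mu x.
Proof.
move=> /path_pair[p1 p2] mu.
have [a ia] := cone_integral _ _ p1 mu; have [b ib] := cone_integral _ _ p2 mu.
by exists (a, b); apply/integral_pair.
Qed.

HB.instance Definition _ := isIntegrableCone.Build R Ar (A * B)%type prod_integral.

End Integrable.
End ProdCone.

(** * Projections and pairing as morphisms *)

Section ProdLinmap.
Context {R : realType} {Ar : arities}.
Implicit Types A B C D : integrableConeType R Ar.

Lemma linmap_fst A B : linmap (fst : A * B -> A).
Proof.
split=> //; first exact: fst_omega.
- by move=> X g pg mu x /integral_pair[].
- by move=> X g /path_pair[].
Qed.

Lemma linmap_snd A B : linmap (snd : A * B -> B).
Proof.
split=> //; first exact: snd_omega.
- by move=> X g pg mu x /integral_pair[].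
- by move=> X g /path_pair[].
Qed.

Lemma linmap_pair A B C (f : C -> A) (g : C -> B) : linmap f -> linmap g ->
  linmap (fun x => (f x, g x)).
Proof.
move=> lf lg; split.
- split=> [x y|a x]; first by rewrite (linmapD lf) (linmapD lg).
  by rewrite (linmapZ lf) (linmapZ lg).
- apply: omega_weak => [x y|_ [[m mm ->]|[m mm ->]]].
  + by rewrite (linmapD lf) (linmapD lg).
  + exact: (linmap_dual lf (mtest_in_dual mm)).
  + exact: (linmap_dual lg (mtest_in_dual mm)).
- move=> X b pb mu x ix; apply/integral_pair; split.
    exact: (lm_int lf).
  exact: (lm_int lg).
- move=> X b pb; apply/path_pair; split; first exact: (lm_path lf).
  exact: (lm_path lg).
Qed.

Lemma csum_pair (K : countType) A B (y : K -> A * B) x :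
  csum (fst \o y) x.1 -> csum (snd \o y) x.2 -> csum y x.
Proof.
move=> y1 y2; apply: csum_weak => _ [[m mm ->]|[m mm ->]].
  exact: (y1 _ (mtest_in_dual mm)).
exact: (y2 _ (mtest_in_dual mm)).
Qed.

Lemma multi_pair A B C (I : finType) (f : (I -> C) -> A) (g : (I -> C) -> B) :
  multi f -> multi g -> multi (fun v => (f v, g v)).
Proof.
move=> mf mg; split=> [i v|X b pb].
  exact: (linmap_pair (m_slice mf i v) (m_slice mg i v)).
apply/path_pair; split; first exact: (m_path mf).
exact: (m_path mg).
Qed.

Lemma analytic_pair A B C (f : uball C -> A) (g : uball C -> B) :
  analytic f -> analytic g -> analytic (fun x => (f x, g x)).
Proof.
move=> /analyticP[[M fM] [hf ff]] /analyticP[[N gN] [hg gg]].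
apply: (@analytic_sum _ _ _ _ _ (Num.max M N) nat (fun n => 'I_n)
  (fun n v => (hf n v, hg n v))).
- by move=> x; apply: cnorm_pair; rewrite le_max ?fM ?gN ?orbT.
- move=> n; apply: multi_pair; first exact: (has_coefs_multi n ff).
  exact: (has_coefs_multi n gg).
- by move=> x; apply: csum_pair; [exact: ff.2|exact: gg.2].
Qed.

Definition hom_pair A B C (f : acones_hom C A) (g : acones_hom C B) :
    acones_hom C (A * B)%type :=
  mk_hom (analytic_pair (ah_analytic f) (ah_analytic g))
    (fun x => cnorm_pair (ah_norm f x) (ah_norm g x)).

Definition hom_fst A B : acones_hom (A * B)%type A :=
  hom_linmap (linmap_fst A B) (@cnorm_fst _ _ _).
Definition hom_snd A B : acones_hom (A * B)%type B :=
  hom_linmap (linmap_snd A B) (@cnorm_snd _ _ _).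

Lemma acones_product A B : is_product (acones R Ar) (hom_fst A B) (hom_snd A B).
Proof.
move=> C f g; exists (hom_pair f g); split.
  by split; apply: acones_hom_ext.
move=> h [<- <-]; apply: acones_hom_ext => x /=.
by rewrite -surjective_pairing.
Qed.

End ProdLinmap.

(** * The cone of analytic functions *)

(** Only the function is recorded: its coefficients are unique, so equality stays pointwise. There
    is no bound by 1, since all multiples are needed to form a cone. *)
Record afun (R : realType) (Ar : arities) (B C : integrableConeType R Ar) : Type :=
  Afun { af_fun :> uball B -> C; af_an : analytic af_fun }.

Section AfunCone.
Context {R : realType} {Ar : arities}.
Variables B C : integrableConeType R Ar.
Local Notation E := (afun B C).

Lemma afun_ext (f g : E) : (forall x, f x = g x) -> f = g.
Proof.
case: f g => [f f0] [g g0] /= /funext fg; case: _ / fg in g0 *.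
by congr Afun; exact: Prop_irrelevance.
Qed.

HB.instance Definition _ := gen_eqMixin E.
HB.instance Definition _ := gen_choiceMixin E.

Lemma in_SymD n (h g : ('I_n -> B) -> C) :
  in_Sym h -> in_Sym g -> in_Sym (fun v => h v + g v).
Proof.
move=> /in_SymP[mh sh] /in_SymP[mg sg]; apply/in_SymP; split; first exact: multiD.
by move=> s v; rewrite sh sg.
Qed.

Lemma in_SymZ n (h : ('I_n -> B) -> C) (a : Rnn R) :
  in_Sym h -> in_Sym (fun v => a *: h v).
Proof.
move=> /in_SymP[mh sh]; apply/in_SymP; split; last by move=> s v; rewrite sh.
exact: (multi_post (linmap_scale _ a) mh).
Qed.

Lemma has_coefsD (f g : uball B -> C) h k : has_coefs f h -> has_coefs g k ->
  has_coefs (fun x => f x + g x) (fun n v => h n v + k n v).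
Proof.
by move=> [hs hf] [ks kg]; split=> [n|x]; [exact: in_SymD|exact: csumD].
Qed.

Lemma has_coefsZ (f : uball B -> C) h (a : Rnn R) : has_coefs f h ->
  has_coefs (fun x => a *: f x) (fun n v => a *: h n v).
Proof.
move=> [hs hf]; split=> [n|x]; first exact: in_SymZ.
exact: (linmap_csum (linmap_scale _ a) (hf x)).
Qed.

Lemma analytic0 : analytic (fun _ : uball B => 0 : C).
Proof. by apply: (analytic_linmap (linmap_zero B C)); exists 0 => x; rewrite cnorm0. Qed.

Lemma analyticD (f g : uball B -> C) : analytic f -> analytic g ->
  analytic (fun x => f x + g x).
Proof.
move=> /analyticP[[M fM] [h fh]] /analyticP[[N gN] [k gk]].
apply/analyticP; split; last by exists (fun n v => h n v + k n v); exact: has_coefsD.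
by exists (M + N) => x; rewrite (le_trans (ler_cnormD _ _))// lerD.
Qed.

Lemma analyticZ (f : uball B -> C) (a : Rnn R) : analytic f ->
  analytic (fun x => a *: f x).
Proof.
move=> /analyticP[[M fM] [h fh]].
apply/analyticP; split; last by exists (fun n v => a *: h n v); exact: has_coefsZ.
by exists (\val a * M) => x; rewrite cnormZ ler_wpM2l// val_Rnn_ge0.
Qed.

Definition afun0 : E := Afun analytic0.
Definition afunD (f g : E) : E := Afun (analyticD (af_an f) (af_an g)).
Definition afunZ (a : Rnn R) (f : E) : E := Afun (analyticZ a (af_an f)).

Lemma afunDA : associative afunD.
Proof. by move=> f g h; apply: afun_ext => x /=; rewrite addrA. Qed.
Lemma afunDC : commutative afunD.
Proof. by move=> f g; apply: afun_ext => x /=; rewrite addrC. Qed.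
Lemma afun0D : left_id afun0 afunD.
Proof. by move=> f; apply: afun_ext => x /=; rewrite add0r. Qed.

HB.instance Definition _ := GRing.isNmodule.Build E afunDA afunDC afun0D.

Lemma afunZA a b (f : E) : afunZ a (afunZ b f) = afunZ (a * b) f.
Proof. by apply: afun_ext => x /=; rewrite scalerA. Qed.
Lemma afun0Z (f : E) : afunZ 0 f = 0.
Proof. by apply: afun_ext => x; exact: scale0r. Qed.
Lemma afun1Z : left_id 1 afunZ.
Proof. by move=> f; apply: afun_ext => x; exact: scale1r. Qed.
Lemma afunZDr : right_distributive afunZ +%R.
Proof. by move=> a f g; apply: afun_ext => x; exact: scalerDr. Qed.
Lemma afunZDl (f : E) : {morph afunZ^~ f : a b / a + b >-> a + b}.
Proof. by move=> a b; apply: afun_ext => x; exact: scalerDl. Qed.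

HB.instance Definition _ := @GRing.Nmodule_isLSemiModule.Build (Rnn R) E afunZ
  afunZA afun0Z afun1Z afunZDr afunZDl.

Lemma afun_addE (f g : E) x : (f + g) x = f x + g x. Proof. by []. Qed.
Lemma afun_scaleE a (f : E) x : (a *: f) x = a *: f x. Proof. by []. Qed.
Lemma afun_sumE (I : Type) (s : seq I) (F : I -> E) x :
  (\sum_(i <- s) F i) x = \sum_(i <- s) F i x.
Proof. by elim/big_rec2: _ => // i y z _ <-. Qed.

Lemma afun_eqx (f g : E) x : f = g -> f x = g x. Proof. by move->. Qed.

Lemma afun_addIr (x x1 x2 : E) : x1 + x = x2 + x -> x1 = x2.
Proof. by move=> e; apply: afun_ext => z; have /precone_addIr := afun_eqx z e. Qed.

Lemma afun_add_eq0 (x1 x2 : E) : x1 + x2 = 0 -> x1 = 0.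
Proof. by move=> e; apply: afun_ext => z; have /precone_add_eq0 := afun_eqx z e. Qed.

HB.instance Definition _ := isPrecone.Build R E afun_addIr afun_add_eq0.

Lemma afun_cle (f g : E) x : cle f g -> cle (f x) (g x).
Proof. by move=> [h ->]; exact: cle_addr. Qed.

Lemma uball0_subproof : cnorm (0 : B) <= 1. Proof. by rewrite cnorm0. Qed.
Definition uball0 : uball B := exist _ 0 uball0_subproof.

Definition afnorm (f : E) : R := sup [set cnorm (f x) | x in [set: uball B]].

Lemma afnorm_ub (f : E) x : cnorm (f x) <= afnorm f.
Proof.
apply: ub_le_sup; last by exists x.
by have [[M fM] _] := af_an f; exists M => _ [z _ <-].
Qed.

Lemma afnorm_le (f : E) M : (forall x, cnorm (f x) <= M) -> afnorm f <= M.
Proof.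
move=> fM; apply: ge_sup; last by move=> _ [z _ <-].
by exists (cnorm (f uball0)), uball0.
Qed.

Lemma afnorm_ge0 f : 0 <= afnorm f.
Proof. exact: le_trans (cnorm_ge0 _) (afnorm_ub f uball0). Qed.

Lemma afnormZ (a : Rnn R) (f : E) : afnorm (a *: f) = \val a * afnorm f.
Proof.
apply/le_anti/andP; split.
  apply: afnorm_le => x; rewrite afun_scaleE cnormZ ler_wpM2l ?val_Rnn_ge0//.
  exact: afnorm_ub.
have [->|an0] := eqVneq (\val a) 0; first by rewrite mul0r afnorm_ge0.
have a0 : 0 < \val a by rewrite lt_def an0 val_Rnn_ge0.
rewrite -ler_pdivlMl//; apply: afnorm_le => x.
by rewrite ler_pdivlMl// -cnormZ -afun_scaleE; exact: afnorm_ub.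
Qed.

Lemma afnorm0 (f : E) : afnorm f = 0 -> f = 0.
Proof.
move=> f0; apply: afun_ext => x; apply/cnorm0_eq0/le_anti.
by rewrite cnorm_ge0 -f0 afnorm_ub.
Qed.

Lemma afnormD (f g : E) : afnorm (f + g) <= afnorm f + afnorm g.
Proof.
apply: afnorm_le => x; rewrite afun_addE (le_trans (ler_cnormD _ _))//.
by rewrite lerD// afnorm_ub.
Qed.

Lemma afnormDr (f g : E) : afnorm f <= afnorm (f + g).
Proof.
apply: afnorm_le => x; apply: le_trans (afnorm_ub _ x).
exact: ler_cnormDr.
Qed.

(** A choice, made canonical by [has_coefs_uniq]; this is why it commutes with sums and scaling. *)
Definition coefs (f : E) : forall n, ('I_n -> B) -> C :=
  projT1 (cid ((analyticP f).1 (af_an f)).2).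
Arguments coefs : clear implicits.

Lemma coefsP (f : E) : has_coefs f (coefs f).
Proof. exact: projT2 (cid _). Qed.

Lemma coefsE (f : E) h n : has_coefs f h -> coefs f n = h n.
Proof. exact: has_coefs_uniq (coefsP f). Qed.

Lemma coefsD (f g : E) n v : coefs (f + g) n v = coefs f n v + coefs g n v.
Proof. by rewrite (coefsE (f := f + g) n (has_coefsD (coefsP f) (coefsP g))). Qed.

Lemma coefsZ a (f : E) n v : coefs (a *: f) n v = a *: coefs f n v.
Proof. by rewrite (coefsE (f := a *: f) n (has_coefsZ a (coefsP f))). Qed.

Lemma coefs_multi (f : E) n : multi (coefs f n).
Proof. exact: has_coefs_multi (coefsP f). Qed.

Lemma coefs_bound (f : E) n M K v : (forall x, cnorm (f x) <= M) ->
  (forall i, cnorm (v i) <= K) ->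
  cnorm (coefs f n v) <= (#|'I_n|%:R * `|K| + 1) ^+ #|'I_n| * M.
Proof.
move=> fM vK; apply: multi_bound => //; first exact: coefs_multi.
move=> x x1; pose x' : uball B := exist (fun x => is_true (cnorm x <= 1)) x x1.
apply: le_trans (fM x').
have := csum_fin_norm (e := fun _ : 'I_1 => n) _ ((coefsP f).2 x').
by rewrite big_ord1; apply=> i j _; rewrite !ord1.
Qed.

(** The double sum over functions and degrees is read in the other order, by degree first. The
    coefficients of the sum are returned as well, because the order and the linearity of [coefs]
    depend on them. *)
Lemma afun_csum_ex (y : nat -> E) (M : R) :
  (forall N x, cnorm (\sum_(k < N) y k x) <= M) ->
  exists2 F : E, (forall x, csum (fun k => y k x) (F x) /\ cnorm (F x) <= M) &
    forall n v, csum (fun k => coefs (y k) n v) (coefs F n v).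
Proof.
move=> yM.
have /choice[F FP] : forall x, exists z, csum (fun k => y k x) z /\ cnorm z <= M.
  by move=> x; have [z zs zM] := @csum_ex _ _ C (fun k => y k x) M (fun N => yM N x); exists z.
have [| |h Fh hs] := @coefs_double_sum _ _ _ _ F M (fun n k => coefs (y k) n) (fun x => (FP x).2).
- by move=> n k; exact: (coefsP (y k)).1.
- move=> x l dl.
  have H := (rsum_pair (a := fun k n => l (coefs (y k) n (fun=> \val x))) _
    (fun _ _ => dual_ge0 dl _) (fun k => (coefsP (y k)).2 x l dl)).1 ((FP x).1 l dl).
  apply/(@rsum_inj _ _ _ (fun p : nat * nat => (p.2, p.1))
    (fun p : nat * nat => l (coefs (y p.1) p.2 (fun=> \val x)))) => //.
  + by move=> [? ?] [? ?] /= [-> ->].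
  + by move=> [k n] /(_ (n, k)); rewrite eqxx.
have aF : analytic F.
  apply/analyticP; split; last by exists h.
  by exists M => x; exact: (FP x).2.
exists (Afun aF) => [x|n v]; first exact: FP.
by rewrite (coefsE (f := Afun aF) n Fh).
Qed.

(** Pointwise lubs are the only candidates, but [cle] demands analytic differences in both halves of
    the lub property. The pointwise description is kept for evaluation. *)
Lemma afun_complete_pt (u : nat -> E) (M : R) : cincreasing u ->
  (forall n, afnorm (u n) <= M) ->
  exists F : E, [/\ is_lub (@cle R E) u F, afnorm F <= M &
    forall x, is_lub (@cle R C) (fun n => u n x) (F x)].
Proof.
move=> iu uM; have [y y0 yu] := cincr_psum iu.
have pE N x : \sum_(k < N) y k x = psum y N x by rewrite /psum afun_sumE.
have pM N x : cnorm (psum y N x) <= M.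
  by case: N => [|N]; [rewrite /psum big_ord0 cnorm0 (le_trans (afnorm_ge0 (u 0%N)))|
    rewrite yu (le_trans (afnorm_ub _ _))].
have [N x|F FP Fc] := @afun_csum_ex y M; first by rewrite pE.
have Fl x : is_lub (@cle R C) (fun n => u n x) (F x).
  have /csum_lub := (FP x).1; rewrite (_ : psum _ = fun N => psum y N x); last first.
    by apply/funext => N; exact: pE.
  have inc : cincreasing (fun N => psum y N x).
    by move=> n; apply: afun_cle; exact: psum_incr.
  move=> /(is_lubS (F x) inc).2.
  by rewrite (_ : (fun n => _) = fun n => u n x)//; apply/funext => n; rewrite yu.
exists F; split=> //; last by apply: afnorm_le => x; exact: (FP x).2.
split=> [N|z uz].
  (* The tail of the series is itself an analytic function. *)
  have [N' x|G GP _] := @afun_csum_ex (fun k => y (k + N.+1)%N) M.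
    apply: le_trans (pM (N.+1 + N')%N x); rewrite -pE big_split_ord/= addrC.
    by under eq_bigr do rewrite addnC; exact: ler_cnormDr.
  exists G; apply: afun_ext => x; rewrite afun_addE -yu -pE.
  apply: (mtest_sep (Ar := Ar)) => m mm; have dm := mtest_in_dual mm.
  have /rsum_natP -/(_ (fun=> dual_ge0 dm _)) cF := (FP x).1 _ dm.
  have /rsum_natP -/(_ (fun=> dual_ge0 dm _)) cG := (GP x).1 _ dm.
  move: cF; rewrite -(cvg_shiftn N.+1) => cF.
  rewrite dualD// dual_sum//.
  apply: (cvg_unique (@Rhausdorff R) cF).
  rewrite (_ : (fun n => _) = fun n : nat => \sum_(i < N.+1) m ar_pt (y i x) +
      \sum_(k < n) (m ar_pt \o (fun k => y (k + N.+1)%N x)) k).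
    by apply: cvgD => //; exact: cvg_cst.
  apply/funext => n; rewrite addnC big_split_ord/=; congr (_ + _).
  by apply: eq_bigr => i _; rewrite addnC.
(* Each partial sum is below [z] with an analytic difference, so the inequality holds for its
   coefficients; those of [F] are the lub. *)
have cz n v : cle (coefs F n v) (coefs z n v).
  have [_] := csum_lub (Fc n v); apply=> N.
  have -> : psum (fun k => coefs (y k) n v) N = coefs (psum y N) n v.
    elim: N => [|N IH]; last by rewrite !psumS IH coefsD.
    rewrite /psum !big_ord0; apply/esym; rewrite -(scale0r (0 : E)) coefsZ.
    by rewrite scale0r.
  have [w ->] : cle (psum y N) z.
    by case: N => [|N]; [exists z; rewrite /psum big_ord0 add0r|rewrite yu].
  by rewrite coefsD; exact: cle_addr.
have /choice[chi chiP] : forall nv : {n & 'I_n -> B}, exists c,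
    coefs z (tag nv) (tagged nv) = coefs F (tag nv) (tagged nv) + c.
  by move=> [n v]; exact: cz.
pose h n v := chi (existT _ n v).
have hP n v : coefs z n v = coefs F n v + h n v by exact: (chiP (existT _ n v)).
have /choice[w wP] : forall x, exists c, z x = F x + c.
  by move=> x; apply: (Fl x).2 => n; exact: afun_cle.
(* The differences [w] of values and [h] of coefficients were chosen independently; cancellation
   shows that [h] is multilinear and symmetric, and that it sums to [w]. *)
have wh : has_coefs w h.
  split=> [n|x l dl].
    apply/in_SymP; split.
      by apply: (multi_diff (hP n)); exact: coefs_multi.
    move=> s v; apply: (@cone_addrI _ _ (coefs F n v)); rewrite -hP.
    have /in_SymP[_ Fs] := (coefsP F).1 n; have /in_SymP[_ zs] := (coefsP z).1 n.
    by rewrite -{1}(Fs s v) -hP zs.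
  apply: (rsumB _ _ ((coefsP z).2 x l dl) ((coefsP F).2 x l dl)).
  - by move=> k; exact: dual_ge0.
  - by move=> k; exact: dual_ge0.
  - by move=> k /=; rewrite hP dualD.
  - by rewrite wP dualD.
have aw : analytic w.
  apply/analyticP; split; last by exists h.
  exists (afnorm z) => x; apply: le_trans (afnorm_ub z x).
  by rewrite wP addrC ler_cnormDr.
by exists (Afun aw); apply: afun_ext => x; exact: wP.
Qed.

Lemma afun_complete (u : nat -> E) : cincreasing u -> (forall n, afnorm (u n) <= 1) ->
  exists2 F : E, is_lub (@cle R E) u F & afnorm F <= 1.
Proof. by move=> iu u1; have [F [uF F1 _]] := afun_complete_pt iu u1; exists F. Qed.

HB.instance Definition _ := isCone.Build R E
  afnorm_ge0 afnormZ afnorm0 afnormD afnormDr afun_complete.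

(** Lubs are unique, so any lub in the function cone is the pointwise one of [afun_complete_pt]. *)
Lemma afun_eval_omega (x : uball B) :
  omega_continuous (@cle R C) (fun f : E => f x).
Proof.
split=> [f g|u F iu [M uM] uF]; first exact: afun_cle.
have [G [uG _ Gx]] := afun_complete_pt iu uM.
by rewrite (is_lub_uniq uF uG); exact: Gx.
Qed.

Lemma afun_eval_dual (x : uball B) (l : C -> R) : in_dual l ->
  in_dual (fun f : E => l (f x)).
Proof. by move=> dl; apply: (omega_dual (f := fun f : E => f x)) => //; exact: afun_eval_omega. Qed.

Definition afun_test (X : ar_ob Ar) : set (X -> E -> R) :=
  [set m | exists (b : X -> uball B) (m' : X -> C -> R),
    [/\ is_path (fun r => \val (b r)), mtest X m' & m = fun r (f : E) => m' r (f (b r))]].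

Lemma afun_test_dual (X : ar_ob Ar) (m : X -> E -> R) : afun_test m ->
  forall r, in_dual (m r).
Proof. by move=> [b [m' [pb mm ->]]] r; apply: afun_eval_dual; exact: mtest_dual. Qed.

Lemma afun_path (f : E) (X : ar_ob Ar) (b : X -> uball B) :
  is_path (fun r => \val (b r)) -> is_path (fun r => f (b r)).
Proof. exact: (analytic_measurable (af_an f)). Qed.

Lemma afun_test_meas (X : ar_ob Ar) (m : X -> E -> R) : afun_test m ->
  forall f : E, cnorm f <= 1 ->
    measurable_fun [set: X] (fun r : X => m r f) /\ (forall r : X, 0 <= m r f <= 1).
Proof.
move=> [b [m' [pb mm ->]]] f f1; split=> [|r].
  have [_ /(_ X m' mm) mf] := afun_path f pb.
  apply: (measurableT_comp mf (g := fun r => (r, r))).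
  exact: measurable_fun_pair.
have fx1 : cnorm (f (b r)) <= 1 by rewrite (le_trans _ f1)// afnorm_ub.
exact: (mtest_meas _ _ mm _ fx1).2.
Qed.

Lemma afun_test_comp (X Y : ar_ob Ar) (phi : Y -> X) (m : X -> E -> R) :
  measurable_fun [set: Y] phi -> afun_test m -> afun_test (fun s x => m (phi s) x).
Proof.
move=> mphi [b [m' [pb mm ->]]].
exists (b \o phi), (fun s x => m' (phi s) x); split=> //.
  exact: (path_comp mphi pb).
exact: mtest_comp.
Qed.

Lemma afun_test_pt (x : uball B) (m : ar_one Ar -> C -> R) : mtest (ar_one Ar) m ->
  afun_test (fun r (f : E) => m r (f x)).
Proof. by move=> mm; exists (fun=> x), m; split=> //; exact: path_cst. Qed.

Lemma afun_test_sep (f g : E) :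
  (forall m, @afun_test (ar_one Ar) m -> m ar_pt f = m ar_pt g) -> f = g.
Proof.
move=> h; apply: afun_ext => x; apply: (mtest_sep (Ar := Ar)) => m mm.
exact: (h _ (afun_test_pt x mm)).
Qed.

Lemma afun_test_norm (f : E) : cnorm f =
  sup [set m ar_pt f / dual_norm (m ar_pt) | m in
     [set m | @afun_test (ar_one Ar) m /\ m ar_pt <> (fun _ : E => 0)]].
Proof.
apply: (@cnorm_testE R E _ ar_pt (@afun_test (ar_one Ar)) f).
- by move=> m pm; exact: afun_test_dual.
- by move=> m /afun_test_meas h y /h[_ /(_ ar_pt)/andP[]].
- move=> M M0 h; apply: afnorm_le => x; apply: cnorm_le => // m mm.
  apply: le_trans (h _ (afun_test_pt x mm)) _; apply: ler_wpM2r => //.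
  (* Evaluation at [x] maps the unit ball of functions into that of [C], so composing [m] with it
     does not increase the dual norm. *)
  apply: ge_sup; first by exists (m ar_pt (0 : C)), 0 => //=; rewrite cnorm0.
  move=> _ [g g1 <-]; apply: ub_le_sup.
    exact: dual_norm_ub (mtest_le1 mm).
  by exists (g x) => //=; rewrite (le_trans _ g1)// afnorm_ub.
Qed.

HB.instance Definition _ := isMeasurableCone.Build R Ar E
  afun_test_dual afun_test_meas afun_test_comp afun_test_sep afun_test_norm.

End AfunCone.
Arguments coefs {R Ar B C} f n v.

(** * Paths of analytic functions, their coefficients and integrals *)

Section AfunIntegral.
Context {R : realType} {Ar : arities}.
Variables B C : integrableConeType R Ar.
Local Notation E := (afun B C).

Lemma path_sum (X : ar_ob Ar) (I : Type) (s : seq I) (b : I -> X -> B) :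
  (forall i, is_path (b i)) -> is_path (fun r => \sum_(i <- s) b i r).
Proof.
move=> pb; elim: s => [|i s IH].
  by under eq_fun do rewrite big_nil; exact: path_cst.
by under eq_fun do rewrite big_cons; exact: pathD.
Qed.

(** An arity [W] isomorphic to [Y * Z] turns the parameter of [m] and that of the point into the
    single parameter of a test on functions. *)
Lemma afun_joint (X Y Z : ar_ob Ar) (g : X -> E) (b : Z -> uball B) (m : Y -> C -> R) :
  is_path g -> is_path (fun z => \val (b z)) -> mtest Y m ->
  measurable_fun [set: Y * (X * Z)] (fun p => m p.1 (g p.2.1 (b p.2.2))).
Proof.
move=> [_ mg] pb mm; have [W [f [f' [mf mf' _ f'K]]]] := ar_prod Y Z.
pose mt (w : W) (F : E) := m (f w).1 (F (b (f w).2)).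
have mtt : mtest W mt.
  exists (fun w => b (f w).2), (fun w x => m (f w).1 x); split=> //.
    exact: (path_comp (measurableT_comp measurable_snd mf) pb).
  apply: (mtest_comp _ _ (fun w => (f w).1) m) => //.
  exact: (measurableT_comp measurable_fst mf).
have mk : measurable_fun setT (fun p : Y * (X * Z) => (f' (p.1, p.2.2), p.2.1)).
  apply: measurable_fun_pair.
    apply: (measurableT_comp mf'); apply: measurable_fun_pair => //.
    exact: (measurableT_comp measurable_snd measurable_snd).
  exact: (measurableT_comp measurable_fst measurable_snd).
have := measurableT_comp (mg W mt mtt) mk.
rewrite (_ : _ \o _ = fun p : Y * (X * Z) => m p.1 (g p.2.1 (b p.2.2)))//.
by apply/funext => -[y [r z]]; rewrite /mt/= f'K.
Qed.

(** The coefficient is a pointwise limit of normalised [pol_diff], each of which is a finite sum of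
    evaluations that [afun_joint] handles. *)
Lemma coefs_joint (X Y Z : ar_ob Ar) (g : X -> E) n (b : 'I_n -> Z -> B)
    (m : Y -> C -> R) : is_path g -> (forall i, is_path (b i)) -> mtest Y m ->
  measurable_fun [set: Y * (X * Z)]
    (fun p => m p.1 (coefs (g p.2.1) n (fun i => b i p.2.2))).
Proof.
move=> pg pb mm.
have /choice[K bK] : forall i, exists K, forall z, cnorm (b i z) <= K.
  by move=> i; case: (pb i).
(* The paths are bounded, so one scale [d^-1] serves for all [z]; [coef_lim] alone would allow it to
   vary with [z]. *)
pose d := \sum_i `|K i| + 1.
have d0 : 0 < d by rewrite ltr_wpDl// sumr_ge0.
have c0 : 0 < d^-1 by rewrite invr_gt0.
have sd z : d^-1 * cnorm (\sum_i b i z) <= 1.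
  rewrite ler_pdivrMl// mulr1 (le_trans (cnorm_sum _))//.
  rewrite (@le_trans _ _ (\sum_i `|K i|)) ?lerDl//; apply: ler_sum => i _.
  by rewrite (le_trans (bK i z))// ler_norm.
have k0 : 0 < d^-1 ^+ n * onto_count n :> R.
  by rewrite mulr_gt0 ?exprn_gt0// onto_count_gt0.
pose u (j : nat) (p : Y * (X * Z)) : R := (d^-1 ^+ n * onto_count n)^-1 *
  (j.+1%:R ^+ n * pol_diff (g p.2.1) (m p.1) (fun i => b i p.2.2) (j.+1%:R^-1 * d^-1)).
apply: (@measurable_fun_cvg _ _ _ _ u) => [j|[y [r z]] _]; last first.
  have sz : cnorm (nnr d^-1 *: \sum_i b i z) <= 1 by rewrite cnorm_nnr ?(ltW c0).
  have := coef_lim (coefsP (g r)) (mtest_dual _ _ mm y) c0 sz.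
  move=> /(cvgM (cvg_cst (d^-1 ^+ n * onto_count n)^-1)).
  by rewrite [d^-1 ^+ n * (_ * _)]mulrA mulKf// gt_eqF.
apply: measurable_funM; first exact: measurable_cst.
apply: measurable_funM; first exact: measurable_cst.
apply: measurable_sum => e.
apply: measurable_funM; first exact: measurable_cst.
set t := j.+1%:R^-1 * d^-1.
have t0 : 0 <= t by rewrite mulr_ge0// ?invr_ge0// ltW.
have td : t <= d^-1.
  by rewrite /t ler_piMl ?(ltW c0)// invf_le1 ?ltr0n// ler1n.
have bt z : cnorm (nnr t *: \sum_i b i z *+ e i) <= 1.
  rewrite cnorm_nnr// (le_trans _ (sd z))//; apply: ler_pM => //.
    exact: cnorm_ge0.
  exact: cle_norm (cle_subsum _ _).
pose b' z : uball B := exist (fun x => is_true (cnorm x <= 1)) _ (bt z).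
have pb' : is_path (fun z => \val (b' z)).
  apply: pathZ; apply: path_sum => i; case: (e i); first exact: pb.
  by under eq_fun do rewrite mulr0n; exact: path_cst.
have := afun_joint pg pb' mm.
rewrite (_ : (fun p : Y * (X * Z) => _) = fun p => m p.1
  (ext_ball (g p.2.1) (nnr t *: \sum_i b i p.2.2 *+ e i)))//.
by apply/funext => p; rewrite (ext_ballT _ (bt p.2.2)).
Qed.

Lemma path_bound (X : ar_ob Ar) (g : X -> E) : is_path g ->
  exists M, forall r x, cnorm (g r x) <= M.
Proof.
by move=> [[M gM] _]; exists M => r x; exact: le_trans (afnorm_ub _ _) (gM r).
Qed.

Lemma coefs_path (X : ar_ob Ar) (g : X -> E) n (b : 'I_n -> X -> B) :
  is_path g -> (forall i, is_path (b i)) ->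
  is_path (fun r => coefs (g r) n (fun i => b i r)).
Proof.
move=> pg pb; have [M gM] := path_bound pg; split=> [|Y m mm].
  have /choice[K bK] : forall i, exists K, forall z, cnorm (b i z) <= K.
    by move=> i; case: (pb i).
  eexists => r; apply: (@coefs_bound _ _ _ _ _ _ _ (\sum_i `|K i|)) => [x|i].
    exact: gM.
  rewrite (le_trans (bK i r))// (le_trans (ler_norm _))// (bigD1 i)//= lerDl.
  by rewrite sumr_ge0.
apply: (measurableT_comp (coefs_joint pg pb mm) (g := fun p : Y * X => (p.1, (p.2, p.2)))).
by apply: measurable_fun_pair => //; exact: measurable_fun_pair.
Qed.

Lemma coefs_pathl (X : ar_ob Ar) (g : X -> E) n (v : 'I_n -> B) :
  is_path g -> is_path (fun r => coefs (g r) n v).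
Proof. by move=> pg; apply: (coefs_path (b := fun i _ => v i) pg) => i; exact: path_cst. Qed.

Lemma eval_path (X : ar_ob Ar) (g : X -> E) (x : uball B) :
  is_path g -> is_path (fun r => g r x).
Proof.
move=> pg; have [M gM] := path_bound pg; split=> [|Y m mm]; first by exists M.
have px : is_path (fun _ : X => \val x) := path_cst _ _.
apply: (measurableT_comp (afun_joint pg px mm) (g := fun p : Y * X => (p.1, (p.2, p.2)))).
by apply: measurable_fun_pair => //; exact: measurable_fun_pair.
Qed.

Lemma is_integral_norm (D : measurableConeType R Ar) (X : ar_ob Ar) (g : X -> D)
    (mu : {finite_measure set X -> \bar R}) (x : D) (M : R) :
  (forall r, cnorm (g r) <= M) -> is_integral g mu x -> is_path g ->
  cnorm x <= M * fine (mu setT).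
Proof.
move=> gM gx pg.
(* The spaces are nonempty, so the bound is attained against some norm and is nonnegative. *)
have M0 : 0 <= M := le_trans (cnorm_ge0 _) (gM point).
have muT : mu setT \is a fin_num by exact: fin_num_measure.
apply: cnorm_le => [|m mm]; first by rewrite mulr_ge0// fine_ge0.
have dm := mtest_in_dual mm.
rewrite -lee_fin gx// mulrA EFinM fineK//.
apply: (@le_trans _ _ (\int[mu]_(r in setT) (dual_norm (m ar_pt) * M)%:E)%E).
  apply: ge0_le_integral => //.
  - by move=> r _; rewrite lee_fin (dual_ge0 dm).
  - by apply/measurable_EFinP; exact: path_meas.
  - move=> r _; rewrite lee_fin (le_trans (mtest_le _ mm))// ler_wpM2l//.
    exact: dual_norm_ge0 (mtest_le1 mm).
by rewrite integral_cst.
Qed.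

(** [F] integrates the values and [H] the coefficients. Joint measurability of coefficients makes
    [H] symmetric multilinear, and integrating the expansion of [g r] term by term shows that [H]
    expands [F]. *)
Lemma afun_integral_coefs (X : ar_ob Ar) (g : X -> E) : is_path g ->
  forall mu : {finite_measure set X -> \bar R}, exists2 F : E, is_integral g mu F &
    forall n v, is_integral (fun r => coefs (g r) n v) mu (coefs F n v).
Proof.
move=> pg mu; have [M gM] := path_bound pg.
have /choice[F FP] : forall x, exists y, is_integral (fun r => g r x) mu y.
  by move=> x; apply: cone_integral; exact: eval_path.
have /choice[H0 H0P] : forall nv : {n & 'I_n -> B}, exists y,
    is_integral (fun r => coefs (g r) (tag nv) (tagged nv)) mu y.
  by move=> [n v]; apply: cone_integral; exact: coefs_pathl.
pose H n v := H0 (existT _ n v).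
have HP n v : is_integral (fun r => coefs (g r) n v) mu (H n v) by exact: (H0P (existT _ n v)).
(* An integral depending on a parameter is measurable in it by Tonelli, once the integrand is
   jointly measurable. *)
have Hpath n (Z : ar_ob Ar) (b : 'I_n -> Z -> B) : (forall i, is_path (b i)) ->
    is_path (fun z => H n (fun i => b i z)).
  move=> pb.
  have /choice[K bK] : forall i, exists K, forall z, cnorm (b i z) <= K.
    by move=> i; case: (pb i).
  split=> [|Y m mm].
    eexists => z; apply: is_integral_norm (HP n _) (coefs_pathl _ pg) => r.
    apply: (@coefs_bound _ _ _ _ _ _ _ (\sum_i `|K i|)) => [x|i]; first exact: gM.
    rewrite (le_trans (bK i z))// (le_trans (ler_norm _))// (bigD1 i)//= lerDl.
    by rewrite sumr_ge0.
  apply/measurable_EFinP.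
  pose G (p : (Y * Z) * X) : \bar R := (m p.1.1 (coefs (g p.2) n (fun i => b i p.1.2)))%:E.
  rewrite (_ : _ \o _ = fun p : Y * Z => (\int[mu]_r G (p, r))%E); last first.
    by apply/funext => p /=; rewrite (is_integralE p.1 (HP n _) mm).
  apply: (measurable_fun_fubini_tonelli_F G); last first.
    by move=> p; rewrite /G lee_fin (dual_ge0 (mtest_dual _ _ mm _)).
  apply/measurable_EFinP.
  apply: (measurableT_comp (coefs_joint pg pb mm)
    (g := fun p : (Y * Z) * X => (p.1.1, (p.2, p.1.2)))).
  apply: measurable_fun_pair; first exact: (measurableT_comp measurable_fst measurable_fst).
  apply: measurable_fun_pair => //.
  exact: (measurableT_comp measurable_snd measurable_fst).
have HS n : in_Sym (H n).
  apply/in_SymP; split; last first.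
    move=> s v; apply: is_integral_uniq (HP n _) _.
    rewrite (_ : (fun r => _) = (fun r => coefs (g r) n v)) //.
    by apply/funext => r; have /in_SymP[_ ->] := (coefsP (g r)).1 n.
  split=> [i v|Z b pb]; last exact: Hpath.
  have sl r := m_slice (coefs_multi (g r) n) i v.
  have D x y : slice (H n) i v (x + y) = slice (H n) i v x + slice (H n) i v y.
    apply: is_integral_uniq (HP n _) _.
    rewrite (_ : (fun r => _) = fun r => slice (coefs (g r) n) i v x + slice (coefs (g r) n) i v y).
      by apply: is_integralD; try exact: coefs_pathl; exact: HP.
    by apply/funext => r; exact: (linmapD (sl r)).
  have Zs (a : Rnn R) x : slice (H n) i v (a *: x) = a *: slice (H n) i v x.
    apply: is_integral_uniq (HP n _) _.
    rewrite (_ : (fun r => _) = fun r => a *: slice (coefs (g r) n) i v x).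
      by apply: is_integralZ; [exact: coefs_pathl|exact: HP].
    by apply/funext => r; exact: (linmapZ (sl r)).
  have Hsl (Z : ar_ob Ar) (b : Z -> B) : is_path b -> forall j, is_path
      ((fun j => @dfwith _ (fun=> Z -> B) (fun j _ => v j) i b j) j).
    by move=> pb j; case: dfwithP => // k _; exact: path_cst.
  have slE (Z : ar_ob Ar) (b : Z -> B) z :
      (fun j => @dfwith _ (fun=> Z -> B) (fun j _ => v j) i b j z) = dfwith v i (b z).
    by apply/funext => j; rewrite !dfwithE; case: eqP.
  split=> //.
  - apply: omega_weak => // m mm; have dm := mtest_in_dual mm.
    apply: in_dual_sigma => [x|x y|a x|y x yx] /=.
    + exact: dual_ge0.
    + by rewrite D dualD.
    + by rewrite Zs dualZ.
    (* Omega-continuity is monotone convergence under the integral over [mu]. *)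
    rewrite /rsum (HP n _ _ mm) -nneseries_esumT => [|k]; last by rewrite lee_fin (dual_ge0 dm).
    under eq_integral => r _.
      rewrite (linmap_csum (sl r) yx dm) -nneseries_esumT => [|k]; last first.
        by rewrite lee_fin (dual_ge0 dm).
      over.
    rewrite integral_nneseries//=.
    + by apply: eq_eseriesr => k _; rewrite -(HP n _ _ mm).
    + by move=> k; apply/measurable_EFinP; apply: path_meas => //; exact: coefs_pathl.
    + by move=> k r _; rewrite lee_fin (dual_ge0 dm).
  (* Integral preservation is the exchange of the integrals over [mu] and [nu]. *)
  - move=> Z b pb nu x ix m mm; have dm := mtest_in_dual mm.
    rewrite (HP n _ _ mm) /=.
    transitivity (\int[mu]_r \int[nu]_z (m ar_pt (slice (coefs (g r) n) i v (b z)))%:E)%E.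
      by apply: eq_integral => r _; rewrite (lm_int (sl r) pb ix mm).
    pose G (p : X * Z) : \bar R := (m ar_pt (slice (coefs (g p.1) n) i v (b p.2)))%:E.
    rewrite (fubini_tonelli G).
    + by apply: eq_integral => z _; rewrite /= (HP n _ _ mm).
    + apply/measurable_EFinP.
      have := measurableT_comp (coefs_joint pg (Hsl Z b pb) mm) (g := fun p : X * Z => (ar_pt, p)).
      have mp : measurable_fun setT (fun p : X * Z => (ar_pt : ar_one Ar, p)).
        by apply: measurable_fun_pair => //; exact: measurable_cst.
      move=> /(_ _ mp); congr measurable_fun; apply/funext => p /=.
      by rewrite slE.
    + by move=> p; rewrite /G lee_fin (dual_ge0 dm).
  - by apply: slice_path => Z b pb; exact: Hpath.
have FH : has_coefs F H.
  split=> // x; apply: csum_weak => m mm; have dm := mtest_in_dual mm.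
  rewrite /rsum (FP x _ mm) -nneseries_esumT => [|k]; last by rewrite lee_fin (dual_ge0 dm).
  under eq_integral => r _.
    rewrite ((coefsP (g r)).2 x _ dm) -nneseries_esumT => [|k]; last first.
      by rewrite lee_fin (dual_ge0 dm).
    over.
  rewrite integral_nneseries//=.
  - by apply: eq_eseriesr => k _; rewrite -(HP k _ _ mm).
  - by move=> k; apply/measurable_EFinP; apply: path_meas => //; exact: coefs_pathl.
  - by move=> k r _; rewrite lee_fin (dual_ge0 dm).
have aF : analytic F.
  apply/analyticP; split; last by exists H.
  exists (M * fine (mu setT)) => x.
  by apply: is_integral_norm (FP x) (eval_path _ pg).
exists (Afun aF) => [_ [b [m [pb mm ->]]]|n v].
  exact: (is_integralE ar_pt (FP (b ar_pt)) mm).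
by rewrite (coefsE (f := Afun aF) n FH); exact: HP.
Qed.

Lemma afun_integral (X : ar_ob Ar) (g : X -> E) : is_path g ->
  forall mu : {finite_measure set X -> \bar R}, exists F : E, is_integral g mu F.
Proof. by move=> pg mu; have [F gF _] := afun_integral_coefs pg mu; exists F. Qed.

HB.instance Definition _ := isIntegrableCone.Build R Ar E afun_integral.

Lemma coefs_integral (X : ar_ob Ar) (g : X -> E) (mu : {finite_measure set X -> \bar R})
    (F : E) n v : is_path g -> is_integral g mu F ->
  is_integral (fun r => coefs (g r) n v) mu (coefs F n v).
Proof.
move=> pg gF; have [G gG Gc] := afun_integral_coefs pg mu.
by rewrite (is_integral_uniq gF gG); exact: Gc.
Qed.

End AfunIntegral.

(** * Cartesian closedness *)

Section Closed.
Context {R : realType} {Ar : arities}.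
Implicit Types A B C D : integrableConeType R Ar.

(** Makes evaluation linear in its function argument, degree by degree. A weak sum of functions is
    in particular pointwise, so [afun_csum_ex] computes the coefficients of its total. *)
Lemma coefs_linmap B C n (w : 'I_n -> B) : linmap (fun F : afun B C => coefs F n w).
Proof.
split.
- by split=> [f g|a f]; [exact: coefsD|exact: coefsZ].
- apply: omega_weak => [f g|m mm]; first exact: coefsD.
  have dm := mtest_in_dual mm.
  apply: in_dual_sigma => [f|f g|a f|y F yF] /=.
  + exact: dual_ge0.
  + by rewrite coefsD dualD.
  + by rewrite coefsZ dualZ.
  have yx x : csum (fun k => y k x) (F x).
    by move=> l dl; exact: (yF _ (afun_eval_dual x dl)).
  have [N x|G GP Gc] := @afun_csum_ex _ _ _ _ y (cnorm F).
    rewrite -afun_sumE; apply: le_trans (afnorm_ub _ x) _.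
    exact: (cle_norm (csum_part_le N yF)).
  have -> : F = G by apply: afun_ext => x; exact: csum_uniq (yx x) (GP x).1.
  exact: (Gc n w _ dm).
- by move=> X g pg mu F gF; exact: coefs_integral.
- by move=> X g pg; exact: coefs_pathl.
Qed.

Definition ball_fst A B (z : uball (A * B)%type) : uball A :=
  exist (fun x => is_true (cnorm x <= 1)) (\val z).1 (le_trans (cnorm_fst _) (proj2_sig z)).
Definition ball_snd A B (z : uball (A * B)%type) : uball B :=
  exist (fun x => is_true (cnorm x <= 1)) (\val z).2 (le_trans (cnorm_snd _) (proj2_sig z)).
Definition ball_pair A B (a : uball A) (b : uball B) : uball (A * B)%type :=
  exist (fun x => is_true (cnorm x <= 1)) (\val a, \val b)
    (cnorm_pair (proj2_sig a) (proj2_sig b)).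

Definition eval_fun B C (z : uball (afun B C * B)%type) : C := (\val z).1 (ball_snd z).

Lemma eval_norm B C (z : uball (afun B C * B)%type) : cnorm (eval_fun z) <= 1.
Proof.
apply: le_trans (afnorm_ub _ _) _.
exact: (proj2_sig (ball_fst z)).
Qed.

(** Of degree [n + 1] in pairs: [None] carries the function, [Some i] the points. *)
Definition eval_term B C n (v : option 'I_n -> (afun B C * B)%type) : C :=
  coefs (v None).1 n (fun i => (v (Some i)).2).

Lemma eval_term_multi B C n : multi (@eval_term B C n).
Proof.
split=> [[i|] v|X b pb]; last first.
  apply: (coefs_path (g := fun r => (b None r).1) (b := fun i r => (b (Some i) r).2)).
    by case/path_pair: (pb None).
  by move=> i; case/path_pair: (pb (Some i)).
- rewrite (_ : slice _ _ _ = (fun F : afun B C => coefs F n (fun i => (v (Some i)).2)) \o fst).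
    exact: (linmap_comp (coefs_linmap _ _) (linmap_fst _ _)).
  apply/funext => x; rewrite /slice /eval_term/= dfwithE eqxx.
  by congr (coefs _ _ _); apply/funext => i; rewrite dfwithE.
- rewrite (_ : slice _ _ _ =
    slice (coefs (v None).1 n) i (fun i => (v (Some i)).2) \o snd).
    exact: (linmap_comp (m_slice (coefs_multi _ _) _ _) (linmap_snd _ _)).
  apply/funext => x; rewrite /slice /eval_term/= dfwithE/=.
  congr (coefs _ _ _); apply/funext => j; rewrite !dfwithE.
  by rewrite (inj_eq Some_inj); case: eqP.
Qed.

Lemma eval_analytic B C : analytic (@eval_fun B C).
Proof.
apply: (@analytic_sum _ _ _ _ _ 1 nat (fun n => option 'I_n) (@eval_term B C)).
- exact: eval_norm.
- exact: eval_term_multi.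
- move=> z; exact: ((coefsP (\val z).1).2 (ball_snd z)).
Qed.

Definition hom_eval B C : acones_hom (afun B C * B)%type C :=
  mk_hom (@eval_analytic B C) (@eval_norm B C).

(** Common form of the two partial multilinearity statements for [mix]. *)
Lemma multi_subst A D C (I K : finType) (h : (I -> D) -> C) (w : (K -> A) -> I -> D)
    (e : K -> I) (p : A -> D) : linmap p ->
  (forall k v x, w (dfwith v k x) = dfwith (w v) (e k) (p x)) ->
  (forall (X : ar_ob Ar) (b : K -> X -> A), (forall k, is_path (b k)) ->
     forall i, is_path (fun r => w (fun k => b k r) i)) ->
  multi h -> multi (fun v => h (w v)).
Proof.
move=> lp we wp mh; split=> [k v|X b pb].
  rewrite (_ : slice _ k v = slice h (e k) (w v) \o p).
    exact: (linmap_comp (m_slice mh _ _) lp).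
  by apply/funext => x; rewrite /slice/= we.
exact: (m_path mh (beta := fun i r => w (fun k => b k r) i) (wp X b pb)).
Qed.

(** * Splitting the arguments of a multilinear map on pairs *)

Section Mix.
Variables (A B : integrableConeType R Ar) (n : nat) (s : {ffun 'I_n -> bool}).
Local Notation K1 := {i : 'I_n | s i}.
Local Notation K2 := {i : 'I_n | ~~ s i}.

(** A pair [(a, b)] is [(a, 0) + (0, b)], so a multilinear map on pairs expands over subsets [s]:
    positions in [s] receive the first summand, the others the second. The final 0 is never
    reached. *)
Definition mix (v : K1 -> A) (u : K2 -> B) (i : 'I_n) : (A * B)%type :=
  if insub i is Some j then (v j, 0) else
  if insub i is Some k then (0, u k) else 0.

Lemma mixl v u j x : mix (dfwith v j x) u = dfwith (mix v u) (val j) (x, 0).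
Proof.
apply/funext => i; rewrite dfwithE /mix; case: insubP => [j' sj' <-|si].
  by rewrite dfwithE val_eqE; case: eqP.
by case: eqP => // ji; move: si; rewrite -ji (valP j).
Qed.

Lemma mixr v u j x : mix v (dfwith u j x) = dfwith (mix v u) (val j) (0, x).
Proof.
apply/funext => i; rewrite dfwithE /mix; case: insubP => [j' sj' <-|si].
  case: eqP => // ji; have := valP j; rewrite ji.
  by rewrite (valP j').
case: insubP => [j' sj' <-|/negP//].
by rewrite dfwithE val_eqE; case: eqP.
Qed.

Lemma mix_path (X : ar_ob Ar) (a : K1 -> X -> A) (b : K2 -> X -> B) i :
  (forall j, is_path (a j)) -> (forall k, is_path (b k)) ->
  is_path (fun r => mix (fun j => a j r) (fun k => b k r) i).
Proof.
move=> pa pb; rewrite /mix; case: insubP => [j _ _|_].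
  by apply/path_pair; split=> /=; [exact: pa|exact: path_cst].
case: insubP => [k _ _|_]; last exact: path_cst.
by apply/path_pair; split=> /=; [exact: path_cst|exact: pb].
Qed.

Lemma mix_norm v u K i : (forall j, cnorm (v j) <= K) -> (forall k, cnorm (u k) <= K) ->
  cnorm (mix v u i) <= `|K|.
Proof.
move=> vK uK; rewrite /mix; case: insubP => [j _ _|_].
  by apply: cnorm_pair; rewrite ?cnorm0// (le_trans (vK j))// ler_norm.
case: insubP => [k _ _|_]; last by rewrite cnorm0.
by apply: cnorm_pair; rewrite ?cnorm0// (le_trans (uK k))// ler_norm.
Qed.

Lemma mix_cst (a : A) (b : B) i :
  mix (fun=> a) (fun=> b) i = if s i then (a, 0) else (0, b).
Proof.
rewrite /mix; case: insubP => [j -> _//|/[dup] si /negPf ->].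
by case: insubP => // /negP; rewrite si.
Qed.

Variables (C : integrableConeType R Ar) (h : ('I_n -> (A * B)%type) -> C) (M : R).
Hypothesis mh : multi h.
Hypothesis hM : forall x : (A * B)%type, cnorm x <= 1 -> cnorm (h (fun=> x)) <= M.

Lemma mix_multil u : multi (fun v => h (mix v u)).
Proof.
apply: (multi_subst (e := val) (p := fun x => (x, 0)) _ _ _ mh).
- exact: (linmap_pair (linmap_id _) (linmap_zero _ _)).
- by move=> j v x; exact: mixl.
- by move=> X b pb i; apply: mix_path => // k; exact: path_cst.
Qed.

Lemma mix_multir v : multi (fun u => h (mix v u)).
Proof.
apply: (multi_subst (e := val) (p := fun x => (0, x)) _ _ _ mh).
- exact: (linmap_pair (linmap_zero _ _) (linmap_id _)).
- by move=> j u x; exact: mixr.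
- by move=> X b pb i; apply: mix_path => // k; exact: path_cst.
Qed.

Lemma mix_bound K : exists M', forall v, (forall j, cnorm (v j) <= K) ->
  forall b : uball B, cnorm (h (mix v (fun=> \val b))) <= M'.
Proof.
(* The maximum with 1 also covers the arguments from [B], which stay in the unit ball. *)
eexists => v vK b; apply: (multi_bound mh hM (K := `|Num.max K 1|)) => i.
apply: mix_norm => [j|k]; first by rewrite le_max vK.
by rewrite le_max (proj2_sig b) orbT.
Qed.

Lemma mix_analytic v : analytic (fun b : uball B => h (mix v (fun=> \val b))).
Proof.
have [M' hM'] := mix_bound (\sum_j cnorm (v j)).
apply: (analytic_multi (mix_multir v) (M := M')) => b; apply: hM' => j.
by rewrite (bigD1 j)//= lerDl sumr_ge0// => *; exact: cnorm_ge0.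
Qed.

Definition curry_term v : afun B C := Afun (mix_analytic v).

Lemma curry_term_path (X : ar_ob Ar) (a : K1 -> X -> A) : (forall j, is_path (a j)) ->
  is_path (fun r => curry_term (fun j => a j r)).
Proof.
move=> pa; split=> [|Y _ [b [m [pb mm ->]]]].
  have /choice[K aK] : forall i, exists K, forall z, cnorm (a i z) <= K.
    by move=> i; case: (pa i).
  have [M' hM'] := mix_bound (\sum_i `|K i|).
  exists M' => r; apply: afnorm_le => x; apply: hM' => i.
  rewrite (le_trans (aK i r))// (le_trans (ler_norm _))// (bigD1 i)//= lerDl.
  by rewrite sumr_ge0.
(* The test brings its own path [b] of arity [Y]. Both paths are pulled back to one arity [W], where
   [h] preserves paths jointly. *)
have [W [f [f' [mf mf' _ f'K]]]] := ar_prod Y X.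
have pd : is_path (fun w => h (mix (fun j => a j (f w).2) (fun=> \val (b (f w).1)))).
  apply: (m_path mh (beta := fun i w => mix (fun j => a j (f w).2) (fun=> \val (b (f w).1)) i)).
  move=> i; apply: mix_path => [j|k].
    exact: (path_comp (measurableT_comp measurable_snd mf) (pa j)).
  exact: (path_comp (measurableT_comp measurable_fst mf) pb).
have mk : measurable_fun setT (fun p : Y * X => (p.1, f' p)).
  by apply: measurable_fun_pair.
have := measurableT_comp (pd.2 Y m mm) mk.
rewrite (_ : _ \o _ = fun p : Y * X =>
  m p.1 (curry_term (fun j => a j p.2) (b p.1)))//.
by apply/funext => p; rewrite /= f'K.
Qed.

Lemma curry_term_multi : multi curry_term.
Proof.
split=> [j v|]; last exact: curry_term_path.
have lb (b : uball B) := m_slice (mix_multil (fun=> \val b)) j v.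
have D x y : slice curry_term j v (x + y) =
    slice curry_term j v x + slice curry_term j v y.
  by apply: afun_ext => b; exact: (linmapD (lb b)).
split.
- by split=> // a x; apply: afun_ext => b; exact: (linmapZ (lb b)).
- apply: omega_weak => // _ [b [m [pb mm ->]]].
  exact: (linmap_dual (lb (b ar_pt)) (mtest_in_dual mm)).
- move=> X g pg mu x gx _ [b [m [pb mm ->]]].
  exact: (lm_int (lb (b ar_pt)) pg gx mm).
- exact: (slice_path j v curry_term_path).
Qed.

End Mix.

(** * Currying a morphism *)

Section Curry.
Variables (A B C : integrableConeType R Ar) (f : acones_hom (A * B)%type C).

Lemma curry_slice_analytic (a : uball A) : analytic (fun b => f (ball_pair a b)).
Proof.
apply: (analytic_comp (f := ball_pair a) _ (ah_analytic f)).
apply: analytic_pair (ah_analytic (hom_id B)).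
(* The constant component of [ball_pair a] is a term of degree 0. *)
have c0 : multi (fun _ : 'I_0 -> B => \val a) by apply: multi_cst; rewrite card_ord.
by apply: (analytic_multi c0 (M := cnorm (\val a))).
Qed.

Definition curry_fun (a : uball A) : afun B C := Afun (curry_slice_analytic a).

Lemma curry_norm a : cnorm (curry_fun a) <= 1.
Proof. by apply: afnorm_le => b; exact: ah_norm. Qed.

(** The degree-[n] part of [f] at [(a, b)] splits over the subsets [s] of positions that receive
    [a]; the term for [s] has degree the size of [s] in [a], with values analytic in [b]. *)
Lemma curry_analytic : analytic curry_fun.
Proof.
have /analyticP[_ [h fh]] := ah_analytic f.
have hM n (x : (A * B)%type) : cnorm x <= 1 -> cnorm (h n (fun=> x)) <= 1.
  move=> x1; pose x' : uball (A * B)%type := exist (fun x => is_true (cnorm x <= 1)) x x1.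
  apply: le_trans (ah_norm f x').
  have := csum_fin_norm (e := fun _ : 'I_1 => n) _ (fh.2 x').
  by rewrite big_ord1; apply=> i j _; rewrite !ord1.
apply: (@analytic_sum _ _ A (afun B C) curry_fun 1 {n : nat & {ffun 'I_n -> bool}}
  (fun j => {i : 'I_(tag j) | tagged j i} : finType)
  (fun j => curry_term (s := tagged j) (has_coefs_multi (tag j) fh) (hM (tag j)))).
- exact: curry_norm.
- by move=> [n s]; exact: curry_term_multi.
move=> a; apply: csum_weak => _ [b [m [pb mm ->]]]; have dm := mtest_in_dual mm.
set x := ball_pair a (b ar_pt).
pose y (s : bool) : (A * B)%type := if s then (\val a, 0) else (0, \val (b ar_pt)).
have ys : csum y (\val x).
  have -> : \val x = \sum_s y s by rewrite big_bool /y /=; congr (_, _); rewrite /= ?addr0 ?add0r.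
  exact: csum_fin.
apply: (eq_rsum (a := fun j : {n : nat & {ffun 'I_n -> bool}} =>
    m ar_pt (h (tag j) (fun i => y (tagged j i))))) => [[n s]|].
  congr (m _ (h _ _)); apply/funext => i.
  by rewrite mix_cst.
apply/(rsum_tag (T := fun n => {ffun 'I_n -> bool})
  (a := fun n (s : {ffun 'I_n -> bool}) => m ar_pt (h n (fun i => y (s i))))
  (s := fun n => m ar_pt (h n (fun=> \val x)))).
- by move=> *; exact: dual_ge0.
- move=> n; apply: (@multi_expand_dual _ _ _ _ bool n (h n) (m ar_pt) (fun _ s => y s)
    (fun=> \val x)) => //.
  exact: (has_coefs_multi n fh).
- exact: (fh.2 x _ dm).
Qed.

Definition hom_curry : acones_hom A (afun B C) := mk_hom curry_analytic curry_norm.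

End Curry.

Lemma uball_eq A (x y : uball A) : \val x = \val y -> x = y.
Proof. exact: val_inj. Qed.

(** The universal property ranges over every product [AB], not only over pairs; [u] compares the
    two, and [f] is curried after composition with it. *)
Lemma acones_exponential B C :
  is_exponential (acones R Ar) (hom_fst (afun B C) B) (hom_snd (afun B C) B) (hom_eval B C).
Proof.
move=> A AB p1 p2 prodAB f.
have [u [[up1 up2] _]] := prodAB _ (hom_fst A B) (hom_snd A B).
have uv1 a b : p1 (ah_ball u (ball_pair a b)) = \val a.
  by rewrite -[LHS]/(cat_comp (acones R Ar) p1 u (ball_pair a b)) up1.
have uv2 a b : p2 (ah_ball u (ball_pair a b)) = \val b.
  by rewrite -[LHS]/(cat_comp (acones R Ar) p2 u (ball_pair a b)) up2.
(* Both the identity and [u] after the pairing of [p1] and [p2] have projections [p1] and [p2], so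
   uniqueness in [prodAB] equates them. *)
have uK z : ah_ball u (ball_pair (ah_ball p1 z) (ah_ball p2 z)) = z.
  have [i [_ iu]] := prodAB _ p1 p2.
  have e1 := iu (hom_id AB) (conj (cat_comp_idr (acones R Ar) p1) (cat_comp_idr (acones R Ar) p2)).
  pose v := cat_comp (acones R Ar) u (hom_pair p1 p2).
  have e2 : i = v.
    apply: iu; rewrite /v !cat_comp_assoc up1 up2.
    by split; apply: acones_hom_ext.
  apply: uball_eq; rewrite -[RHS]/(hom_id AB z) -e1 e2 /=.
  by congr (u _); exact: uball_eq.
exists (hom_curry (cat_comp (acones R Ar) f u)); split.
  exists (hom_pair (hom_comp (hom_curry (hom_comp f u)) p1) p2); split.
  - exact: acones_hom_ext.
  - exact: acones_hom_ext.
  apply: acones_hom_ext => z /=; rewrite -[in RHS](uK z) /eval_fun /=.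
  by congr (f _); apply: uball_eq => /=; congr (u _); exact: uball_eq.
move=> g [k [kp1 kp2 kf]]; apply: acones_hom_ext => a; apply: afun_ext => b /=.
set z := ah_ball u (ball_pair a b).
rewrite -[in LHS]/z -kf /= /eval_fun /=.
have k1 : (k z).1 = g a.
  rewrite -[LHS]/(cat_comp (acones R Ar) (hom_fst _ _) k z) kp1 /=.
  by congr (g _); apply: uball_eq; exact: uv1.
rewrite k1; congr (g a _); apply: uball_eq => /=.
rewrite -[LHS]/(cat_comp (acones R Ar) (hom_snd _ _) k z) kp2.
exact: uv2.
Qed.

End Closed.

Theorem theorem8p19 (R : realType) (Ar : arities) :
  exists K : category (@acones_hom R Ar),
    [/\ forall (B : integrableConeType R Ar) (x : uball B),
          cat_id K B x = proj1_sig x,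
        forall (B C D : integrableConeType R Ar)
          (g : acones_hom C D) (f : acones_hom B C) (x : uball B),
          cat_comp K g f x = g (ah_ball f x)
      & cartesian_closed K].
Proof.
exists (acones R Ar); split=> //; split.
- by exists (one_cone R Ar); exact: one_terminal.
- move=> A B; exists (A * B)%type, (hom_fst A B), (hom_snd A B).
  exact: acones_product.
- move=> B C; exists (afun B C), (afun B C * B)%type, (hom_fst _ _), (hom_snd _ _), (hom_eval B C).
  by split; [exact: acones_product|exact: acones_exponential].
Qed.
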